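(* Let $k$ be a field and let $A$ be a pseudocompact $k$-algebra with Jacobson radical $J=J(A)$ such that $A/J$ is separable. Then the canonical projection $A\to A/J$ splits continuously as an algebra homomorphism; that is, there is a continuous $k$-algebra homomorphism $s:A/J\to A$ whose composition with the canonical projection $A\to A/J$ is the identity of $A/J$.
   Context: $k$ is a field with the discrete topology. A pseudocompact $k$-algebra is a topological (associative, unital) $k$-algebra that is an inverse limit of discrete finite dimensional $k$-algebras and algebra homomorphisms; equivalently, it has a basis of neighbourhoods of $0$ consisting of ideals of finite codimension whose intersection is $0$, and it is complete. The Jacobson radical $J(A)$ is the intersection of the maximal closed left ideals of $A$ (it is a closed two-sided ideal, and coincides with the usual Jacobson radical of $A$ as an abstract algebra). A pseudocompact algebra $B$ is topologically semisimple if for every closed left ideal $I$ of $B$ there is a closed left ideal $L$ with $B=I\oplus L$. A pseudocompact $k$-algebra $B$ is separable if $B\widehat{\otimes}_k E$ is a topologically semisimple algebra over $E$ for every finite extension field $E$ of $k$, where $\widehat{\otimes}_k$ is the completed tensor product (which agrees with $\otimes_k$ here since $E$ is finite dimensional over $k$). *)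

(* Defs.v *)
From HB Require Import structures.
From mathcomp Require Import all_boot all_algebra fieldext.
From mathcomp Require Import all_classical topology tvs.

Set Implicit Arguments.
Unset Strict Implicit.
Unset Printing Implicit Defensive.

Import GRing.Theory.
Local Open Scope classical_set_scope.
Local Open Scope ring_scope.
Local Open Scope quotient_scope.

(* A k-algebra is presented as a ring with a central ring morphism from k:
   MathComp's [algType] excludes the zero algebra. Scalar multiplication is
   multiplication by [talg_in c]; as k is discrete, its continuity follows from
   that of the product. *)
HB.mixin Record isTopAlgebra (k : pzRingType) A
    of GRing.PzRing A & TopologicalZmodule A := {
  talg_in : {rmorphism k -> A};
  talg_inC : forall (c : k) (x : A), talg_in c * x = x * talg_in c;
  talg_mul_continuous : continuous (fun z : A * A => z.1 * z.2)
}.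

#[short(type="topAlgType")]
HB.structure Definition TopAlgebra (k : pzRingType) :=
  {A of GRing.PzRing A & TopologicalZmodule A & isTopAlgebra k A}.

Definition left_ideal (R : pzRingType) (I : set R) : Prop :=
  [/\ I 0, forall x y, I x -> I y -> I (x + y)
    & forall a x, I x -> I (a * x)].

Definition two_sided_ideal (R : pzRingType) (I : set R) : Prop :=
  left_ideal I /\ forall x a, I x -> I (x * a).

Definition finite_codim (k : fieldType) (A : topAlgType k) (I : set A) : Prop :=
  exists (n : nat) (v : 'I_n -> A), forall x : A,
    exists c : 'I_n -> k, I (x - \sum_i talg_in (c i) * v i).

(* Completeness for the uniformity of the additive topological group. *)
Definition cauchy_filter (k : pzRingType) (A : topAlgType k)
    (F : set_system A) : Prop :=
  forall U : set A, nbhs 0 U ->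
    exists2 X : set A, F X & forall x y, X x -> X y -> U (x - y).

HB.mixin Record isPseudocompact (k : fieldType) A of TopAlgebra k A := {
  pc_basis : exists B : set (set A),
    [/\ forall I, B I ->
          [/\ two_sided_ideal I, nbhs (0 : A) I & finite_codim I],
        forall U, nbhs (0 : A) U -> exists2 I, B I & I `<=` U
      & \bigcap_(I in B) I = [set 0]];
  pc_complete : forall F : set_system A, ProperFilter F ->
    cauchy_filter F -> exists a : A, F --> a
}.

#[short(type="pseudocompactAlgType")]
HB.structure Definition PseudocompactAlgebra (k : fieldType) :=
  {A of TopAlgebra k A & isPseudocompact k A}.

Definition maximal_closed_left_ideal (k : fieldType) (A : topAlgType k)
    (M : set A) : Prop :=
  [/\ closed M, left_ideal M, M <> setT
    & forall N : set A, closed N -> left_ideal N -> N <> setT ->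
        M `<=` N -> N = M].

Definition jacobson (k : fieldType) (A : topAlgType k) : set A :=
  \bigcap_(M in [set M | maximal_closed_left_ideal M]) M.
Arguments jacobson {k} A.

HB.mixin Record isTwoSidedIdeal (R : pzRingType) (S : R -> bool) := {
  tsideal_mull : forall a x : R, x \in S -> a * x \in S;
  tsideal_mulr : forall a x : R, x \in S -> x * a \in S
}.

#[short(type="tsideal")]
HB.structure Definition TwoSidedIdeal (R : pzRingType) :=
  {S of GRing.ZmodClosed R S & isTwoSidedIdeal R S}.

Definition quotAlg (k : fieldType) (A : topAlgType k) (I : tsideal A) : Type :=
  quotient_topology (Quotient.quot I).

Section QuotAlg.
Variables (k : fieldType) (A : topAlgType k) (I : tsideal A).
Local Notation Q := (quotAlg I).

HB.instance Definition _ := Topological.on Q.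
HB.instance Definition _ := Quotient.on Q.
HB.instance Definition _ := GRing.isZmodule.Build Q
  (@Quotient.addqA _ I) (@Quotient.addqC _ I)
  (@Quotient.add0q _ I) (@Quotient.addNq _ I).

Definition quot_pi (x : A) : Q := \pi_Q x.

Lemma quot_piP (q : Q) : exists x, q = quot_pi x.
Proof. by exists (repr q); rewrite /quot_pi reprK. Qed.

Lemma quot_pi_eq x y : (quot_pi x = quot_pi y) <-> (x - y \in I).
Proof.
by rewrite (Quotient.idealrBE I); split => [xy|/eqP //]; apply/eqP.
Qed.

Lemma quot_pi0 : quot_pi 0 = 0.
Proof. exact: (@pi_zeror _ _ _ _ _ (Quotient.quot I)). Qed.

Lemma quot_piD : {morph quot_pi : x y / x + y}.
Proof. exact: (@pi_addr _ _ _ _ _ (Quotient.quot I)). Qed.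

Lemma quot_piN : {morph quot_pi : x / - x}.
Proof. exact: (@pi_oppr _ _ _ _ _ (Quotient.quot I)). Qed.

Definition quot_one : Q := quot_pi 1.
Definition quot_mul (p q : Q) : Q := quot_pi (repr p * repr q).

Lemma repr_quot_pi x : repr (quot_pi x) - x \in I.
Proof. by apply/quot_pi_eq; rewrite /quot_pi reprK. Qed.

Lemma quot_piM x y : quot_pi (x * y) = quot_mul (quot_pi x) (quot_pi y).
Proof.
apply/esym/quot_pi_eq; set x' := repr _; set y' := repr _.
have -> : x' * y' - x * y = (x' - x) * y' + x * (y' - y).
  by rewrite mulrBl mulrBr addrA subrK.
by apply: rpredD; [apply: tsideal_mulr | apply: tsideal_mull]; exact: repr_quot_pi.
Qed.

Fact quot_mulA : associative quot_mul.
Proof.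
move=> p q r; case: (quot_piP p) (quot_piP q) (quot_piP r) => [x ->] [y ->] [z ->].
by rewrite -!quot_piM mulrA.
Qed.

Fact quot_mul1 : left_id quot_one quot_mul.
Proof. by move=> p; case: (quot_piP p) => x ->; rewrite -quot_piM mul1r. Qed.

Fact quot_mulr1 : right_id quot_one quot_mul.
Proof. by move=> p; case: (quot_piP p) => x ->; rewrite -quot_piM mulr1. Qed.

Fact quot_mulDl : left_distributive quot_mul +%R.
Proof.
move=> p q r; case: (quot_piP p) (quot_piP q) (quot_piP r) => [x ->] [y ->] [z ->].
by rewrite -quot_piD -!quot_piM -quot_piD mulrDl.
Qed.

Fact quot_mulDr : right_distributive quot_mul +%R.
Proof.
move=> p q r; case: (quot_piP p) (quot_piP q) (quot_piP r) => [x ->] [y ->] [z ->].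
by rewrite -quot_piD -!quot_piM -quot_piD mulrDr.
Qed.

HB.instance Definition _ := GRing.Zmodule_isPzRing.Build Q
  quot_mulA quot_mul1 quot_mulr1 quot_mulDl quot_mulDr.

Fact quot_pi_zmod_morphism : zmod_morphism quot_pi.
Proof. by move=> x y; rewrite quot_piD quot_piN. Qed.

Fact quot_pi_monoid_morphism : monoid_morphism quot_pi.
Proof. by split=> // x y; rewrite quot_piM. Qed.

HB.instance Definition _ :=
  GRing.isZmodMorphism.Build A Q quot_pi quot_pi_zmod_morphism.
HB.instance Definition _ :=
  GRing.isMonoidMorphism.Build A Q quot_pi quot_pi_monoid_morphism.

Lemma quot_pi_continuous : continuous quot_pi.
Proof. exact: pi_continuous. Qed.

Lemma quot_pi_open (x : A) (U : set A) : nbhs x U -> nbhs (quot_pi x) (quot_pi @` U).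
Proof.
rewrite nbhsE => -[V [oV Vx] VU]; apply: (@filterS _ _ _ (quot_pi @` V)).
  by move=> _ [v Vv <-]; exists v => //; exact: VU.
apply: open_nbhs_nbhs; split; last by exists x.
suff : open (quot_pi @^-1` (quot_pi @` V)) by [].
rewrite openE => y /= [v Vv /esym/quot_pi_eq yv].
have sh : (fun z => z - (y - v)) @ y --> v.
  rewrite -[X in _ --> X](_ : y - (y - v) = v); last by rewrite opprB addrC subrK.
  apply: (@continuous_comp _ _ _ (fun z : A => (z, - (y - v)))
    (fun z : A * A => z.1 + z.2)); last exact: add_continuous.
  by apply: cvg_pair => /=; [exact: cvg_id | exact: cvg_cst].
have : nbhs y ((fun z => z - (y - v)) @^-1` V).
  by apply: sh; exact: open_nbhs_nbhs.
rewrite /interior; apply: filterS => z /= Vz; exists (z - (y - v)) => //.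
by apply/quot_pi_eq; rewrite addrAC subrr sub0r rpredN.
Qed.

Let quot_continuous2 (f : A * A -> A) (g : Q * Q -> Q) :
  (forall x y, g (quot_pi x, quot_pi y) = quot_pi (f (x, y))) ->
  continuous f -> continuous g.
Proof.
move=> gf fc [p q]; have [x ->] := quot_piP p; have [y ->] := quot_piP q => U.
rewrite gf => /quot_pi_continuous /fc [[/= P R] [Px Ry] PRU].
exists (quot_pi @` P, quot_pi @` R); first by split; exact: quot_pi_open.
move=> [_ _] [/= [a Pa <-] [b Rb <-]].
by have := PRU (a, b) (conj Pa Rb); rewrite /= gf.
Qed.

Fact quot_add_continuous : continuous (fun z : Q * Q => z.1 + z.2).
Proof.
apply: (@quot_continuous2 (fun z => z.1 + z.2)); last exact: add_continuous.
by move=> x y; rewrite /= quot_piD.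
Qed.

Fact quot_opp_continuous : continuous (-%R : Q -> Q).
Proof.
apply/(quotient_continuous (Q0 := Quotient.quot I)).
move=> x U; rewrite /= -[- _]quot_piN => /quot_pi_continuous/opp_continuous.
by rewrite !nbhs_simpl /=; apply: filterS => y /=; rewrite quot_piN.
Qed.

HB.instance Definition _ :=
  PreTopologicalNmodule_isTopologicalNmodule.Build Q quot_add_continuous.
HB.instance Definition _ :=
  TopologicalNmodule_isTopologicalZmodule.Build Q quot_opp_continuous.

Definition quot_in : {rmorphism k -> Q} := quot_pi \o talg_in.

Fact quot_inC (c : k) (q : Q) : quot_in c * q = q * quot_in c.
Proof. by case: (quot_piP q) => x ->; rewrite /= -!rmorphM talg_inC. Qed.

Fact quot_mul_continuous : continuous (fun z : Q * Q => z.1 * z.2).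
Proof.
apply: (@quot_continuous2 (fun z => z.1 * z.2)); last exact: talg_mul_continuous.
by move=> x y; rewrite /= quot_piM.
Qed.

HB.instance Definition _ :=
  isTopAlgebra.Build k Q quot_inC quot_mul_continuous.

Lemma quot_pi_in (c : k) : quot_pi (talg_in c) = talg_in c.
Proof. by []. Qed.

End QuotAlg.

Section Jacobson.
Variables (k : fieldType) (A : pseudocompactAlgType k).
Implicit Types M N U : set A.

Let left_idealN M x : left_ideal M -> M x -> M (- x).
Proof. by case=> _ _ Mm Mx; rewrite -mulN1r; exact: Mm. Qed.

Let translate_continuous (a : A) : continuous (fun z : A => a + z).
Proof.
move=> x; apply: (@continuous_comp _ _ _ (fun z : A => (a, z))
  (fun z : A * A => z.1 + z.2)); last exact: add_continuous.
by apply: cvg_pair => /=; [exact: cvg_cst | exact: cvg_id].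
Qed.

Let nbhs_shift x U : nbhs 0 U -> nbhs x [set z | U (z - x)].
Proof.
rewrite -{1}(addNr x) => /(@translate_continuous (- x) x) xU.
have {xU} : nbhs x ((fun z => - x + z) @^-1` U) by exact: xU.
by apply: filterS => z /=; rewrite addrC.
Qed.

Let left_ideal_closed M : left_ideal M -> nbhs 0 M -> closed M.
Proof.
move=> Ml M0 x Mx; have [_ MD _] := Ml.
have [y [My Mxy]] := Mx _ (nbhs_shift x M0).
by rewrite -[x](subKr y); apply: MD => //; exact: left_idealN.
Qed.

Let left_ideal_proper M : left_ideal M -> M <> setT -> ~ M 1.
Proof.
case=> _ _ Mm MT M1; apply: MT; rewrite eqEsubset; split=> // x _.
by rewrite -[x]mulr1; exact: Mm.
Qed.

Let maximal_nbhs M : maximal_closed_left_ideal M -> nbhs 0 M.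
Proof.
case=> Mc Ml MT Mmax; have M1 := left_ideal_proper Ml MT.
have [B [BI BU _]] := @pc_basis k A.
have : nbhs 0 [set z : A | ~ M (1 + z)].
  have : nbhs (1 + 0 : A) (~` M).
    by rewrite addr0; apply: open_nbhs_nbhs; split=> //; exact: closed_openC.
  exact: translate_continuous.
move=> /BU [I IB IM]; have [[Il _] I0 _] := BI _ IB.
have [M0 MD Mm] := Ml; have [Io ID Im] := Il.
pose N := [set z | exists m i, [/\ M m, I i & z = m + i]].
have Nl : left_ideal N.
  split; first by exists 0, 0; rewrite addr0.
    move=> _ _ [m [i [Mi Ii ->]]] [m' [i' [Mi' Ii' ->]]].
    by exists (m + m'), (i + i'); rewrite addrACA; split; [exact: MD | exact: ID |].
  move=> a _ [m [i [Mi Ii ->]]].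
  by exists (a * m), (a * i); rewrite mulrDr; split; [exact: Mm | exact: Im |].
have IN : I `<=` N by move=> i Ii; exists 0, i; rewrite add0r.
have N0 : nbhs 0 N by exact: filterS I0.
have NT : N <> setT.
  move=> NE; have : N 1 by rewrite NE.
  move=> [m [i [Mi Ii E]]]; have := IM _ (left_idealN Il Ii); apply.
  by rewrite E addrK.
rewrite -(Mmax N) //; first exact: left_ideal_closed.
by move=> m Mi; exists m, 0; rewrite addr0.
Qed.

Lemma jacobson_two_sided : two_sided_ideal (jacobson A).
Proof.
split; first split.
- by move=> M [_ []].
- by move=> x y Jx Jy M Mm; have [_ [_ MD _] _ _] := Mm; apply: MD; [exact: Jx | exact: Jy].
- by move=> a x Jx M Mm; have [_ [_ _ Ma] _ _] := Mm; apply: Ma; exact: Jx.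
move=> x a Jx M Mm; have [Mc Ml MT Mmax] := Mm; have [M0 MD Mmul] := Ml.
pose N := [set b | M (b * a)].
have Nl : left_ideal N.
  split; rewrite /N /=; first by rewrite mul0r.
    by move=> b c Mb Mc'; rewrite mulrDl; exact: MD.
  by move=> b c Mc'; rewrite -mulrA; exact: Mmul.
have Nc : closed N.
  apply: (@preimage_closed _ _ (fun b : A => b * a) M) => // y _.
  apply: (@continuous_comp _ _ _ (fun z : A => (z, a))
    (fun z : A * A => z.1 * z.2)); last exact: talg_mul_continuous.
  by apply: cvg_pair => /=; [exact: cvg_id | exact: cvg_cst].
have [NT|NT] := pselect (N = setT).
  by have : N x by rewrite NT.
suff /Jx : maximal_closed_left_ideal N by [].
split=> // N' N'c N'l N'T NN'; rewrite eqEsubset; split=> // b N'b.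
apply: contrapT => Nb; apply: (left_ideal_proper N'l N'T).
have [N'0 N'D N'm] := N'l.
pose P := [set z | exists n m, [/\ N' n, M m & z = n * a + m]].
have Pl : left_ideal P.
  split; first by exists 0, 0; rewrite mul0r addr0.
    move=> _ _ [n [m [Nn Mi ->]]] [n' [m' [Nn' Mi' ->]]].
    exists (n + n'), (m + m'); rewrite mulrDl addrACA.
    by split; [exact: N'D | exact: MD |].
  move=> c _ [n [m [Nn Mi ->]]]; exists (c * n), (c * m).
  by rewrite mulrDr mulrA; split; [exact: N'm | exact: Mmul |].
have MP : M `<=` P by move=> m Mi; exists 0, m; rewrite mul0r add0r.
have Pc : closed P.
  by apply: left_ideal_closed => //; apply: (filterS MP); exact: maximal_nbhs.
have PT : P = setT.
  apply: contrapT => PT; apply: Nb; rewrite /N /= -(Mmax P) //.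
  by exists b, 0; rewrite addr0.
have : P a by rewrite PT.
move=> [n [m [N'n Mi E]]].
have N1 : N' (1 - n).
  by apply: NN'; rewrite /N /= mulrBl mul1r {1}E addrAC subrr add0r.
by rewrite -(subrK n 1); exact: N'D.
Qed.

Definition jacobson_pred : {pred A} := fun x => x \in jacobson A.

Fact jacobson_zmod_closed : zmod_closed jacobson_pred.
Proof.
have [Jl _] := jacobson_two_sided; have [J0 JD _] := Jl.
split; first exact: mem_set.
move=> x y /set_mem Jx /set_mem Jy; apply: mem_set.
exact: (JD _ _ Jx (left_idealN Jl Jy)).
Qed.

Fact jacobson_mull (a x : A) : x \in jacobson_pred -> a * x \in jacobson_pred.
Proof.
by have [[_ _ Jm] _] := jacobson_two_sided => /set_mem Jx; apply: mem_set; exact: Jm.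
Qed.

Fact jacobson_mulr (a x : A) : x \in jacobson_pred -> x * a \in jacobson_pred.
Proof.
by have [_ Jm] := jacobson_two_sided => /set_mem Jx; apply: mem_set; exact: Jm.
Qed.

HB.instance Definition _ :=
  GRing.isZmodClosed.Build A jacobson_pred jacobson_zmod_closed.
HB.instance Definition _ :=
  isTwoSidedIdeal.Build A jacobson_pred jacobson_mull jacobson_mulr.

Definition mod_jacobson : topAlgType k := quotAlg jacobson_pred.

Definition mod_jacobson_proj : {rmorphism A -> mod_jacobson} :=
  @quot_pi k A jacobson_pred.

Lemma mod_jacobson_ker (x : A) : mod_jacobson_proj x = 0 <-> jacobson A x.
Proof.
rewrite -[0](rmorph0 mod_jacobson_proj).
split=> [/quot_pi_eq|Jx]; first by rewrite subr0 => /set_mem.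
by apply/quot_pi_eq; rewrite subr0; exact: mem_set.
Qed.

End Jacobson.
Arguments mod_jacobson {k} A.
Arguments mod_jacobson_proj {k} A.

Section TopAlgebraContinuity.
Variables (k : pzRingType) (A : topAlgType k) (T : topologicalType).
Implicit Types f g : T -> A.

Lemma talg_continuousD f g :
  continuous f -> continuous g -> continuous (fun t => f t + g t).
Proof.
move=> fc gc t; apply: (@continuous_comp _ _ _ (fun s => (f s, g s))
  (fun z : A * A => z.1 + z.2)); last exact: add_continuous.
by apply: cvg_pair; [exact: fc | exact: gc].
Qed.

Lemma talg_continuousM f g :
  continuous f -> continuous g -> continuous (fun t => f t * g t).
Proof.
move=> fc gc t; apply: (@continuous_comp _ _ _ (fun s => (f s, g s))
  (fun z : A * A => z.1 * z.2)); last exact: talg_mul_continuous.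
by apply: cvg_pair; [exact: fc | exact: gc].
Qed.

Lemma talg_continuous_sum (I : Type) (r : seq I) (F : I -> T -> A) :
  (forall i, continuous (F i)) -> continuous (fun t => \sum_(i <- r) F i t).
Proof.
move=> Fc; elim: r => [|i r IHr].
  by under eq_fun do rewrite big_nil; exact: cst_continuous.
by under eq_fun do rewrite big_cons; exact: talg_continuousD.
Qed.

End TopAlgebraContinuity.

(* B \otimes_k E = \bigoplus_i B \otimes e_i for the basis (e_i) of E over k: the
   row x stands for \sum_i x_i \otimes e_i, and the topology is the product one. *)

Definition baseChange (k : fieldType) (B : topAlgType k) (E : fieldExtType k) : Type :=
  'rV[B]_(\dim {:E}).

Section BaseChange.
Variables (k : fieldType) (B : topAlgType k) (E : fieldExtType k).
Local Notation n := (\dim {:E}).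
Local Notation e := (fun i : 'I_n => (vbasis {:E})`_i).
Local Notation cc := (coord (vbasis {:E})).
Local Notation BE := (baseChange B E).

HB.instance Definition _ := Topological.copy BE 'rV[B]_n.
HB.instance Definition _ := GRing.Zmodule.copy BE 'rV[B]_n.

Definition tens (b : B) (u : E) : BE := \row_l (talg_in (cc l u) * b).

Definition tens_mul (x y : BE) : BE :=
  \row_l \sum_i \sum_j talg_in (cc l (e i * e j)) * (x 0 i * y 0 j).

Lemma tensDl u : {morph tens^~ u : b c / b + c}.
Proof. by move=> b c; apply/rowP=> l; rewrite !mxE mulrDr. Qed.

Lemma tensDr b : {morph tens b : u v / u + v}.
Proof. by move=> u v; apply/rowP=> l; rewrite !mxE !raddfD mulrDl. Qed.

Lemma tensZ (c : k) b u : tens (talg_in c * b) u = tens b (c *: u).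
Proof.
apply/rowP=> l; rewrite !mxE linearZ /= rmorphM mulrA.
by rewrite -(talg_inC (cc l u)).
Qed.

Lemma tens_basis b i l : (tens b (e i) : 'rV[B]_n) 0 l = b *+ (i == l).
Proof.
rewrite mxE coord_free ?(basis_free (vbasisP _)) //.
by case: eqP; rewrite ?rmorph1 ?rmorph0 ?mul1r ?mul0r.
Qed.

Lemma tens_sum (x : BE) : x = \sum_i tens (x 0 i) (e i).
Proof.
apply/rowP=> l; rewrite summxE (bigD1 l) //= tens_basis eqxx big1 ?addr0 // => i.
by rewrite tens_basis => /negPf->.
Qed.

Fact tens_mulDl : left_distributive tens_mul +%R.
Proof.
move=> x y z; apply/rowP=> l; rewrite !mxE -big_split; apply: eq_bigr => i _ /=.
by rewrite -big_split; apply: eq_bigr => j _ /=; rewrite mxE mulrDl mulrDr.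
Qed.

Fact tens_mulDr : right_distributive tens_mul +%R.
Proof.
move=> x y z; apply/rowP=> l; rewrite !mxE -big_split; apply: eq_bigr => i _ /=.
by rewrite -big_split; apply: eq_bigr => j _ /=; rewrite mxE mulrDr mulrDr.
Qed.

Lemma tensM b c u v : tens_mul (tens b u) (tens c v) = tens (b * c) (u * v).
Proof.
apply/rowP=> l; rewrite !mxE.
rewrite {2}(coord_vbasis (memvf u)) {2}(coord_vbasis (memvf v)).
rewrite mulr_suml linear_sum rmorph_sum mulr_suml; apply: eq_bigr => i _.
rewrite mulr_sumr linear_sum rmorph_sum mulr_suml; apply: eq_bigr => j _.
rewrite !mxE /= -scalerAl -scalerAr !linearZ /= !rmorphM.
rewrite -[_ * b * _]mulrA [b * (_ * c)]mulrA -(talg_inC _ b) !mulrA.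
congr (_ * c); congr (_ * b).
by rewrite -!rmorphM /= -mulrA [in LHS]mulrC.
Qed.

Lemma tens_ind (P : BE -> Prop) :
  P 0 -> (forall x y, P x -> P y -> P (x + y)) -> (forall b u, P (tens b u)) ->
  forall x, P x.
Proof. by move=> P0 PD PT x; rewrite [x]tens_sum; elim/big_ind: _. Qed.

Let tens_mul0x (y : BE) : tens_mul 0 y = 0.
Proof. by apply: (@addIr _ (tens_mul 0 y)); rewrite -tens_mulDl !add0r. Qed.

Let tens_mulx0 (y : BE) : tens_mul y 0 = 0.
Proof. by apply: (@addIr _ (tens_mul y 0)); rewrite -tens_mulDr !add0r. Qed.

Fact tens_mulA : associative tens_mul.
Proof.
move=> x y z; elim/tens_ind: x => [|x x' Hx Hx'|b u].
- by rewrite !tens_mul0x.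
- by rewrite !tens_mulDl Hx Hx'.
elim/tens_ind: y => [|y y' Hy Hy'|c v].
- by rewrite !(tens_mul0x, tens_mulx0).
- by rewrite !(tens_mulDl, tens_mulDr) Hy Hy'.
elim/tens_ind: z => [|z z' Hz Hz'|d w].
- by rewrite !tens_mulx0.
- by rewrite !tens_mulDr Hz Hz'.
by rewrite !tensM !mulrA.
Qed.

Fact tens_mul1 : left_id (tens 1 1) tens_mul.
Proof.
elim/tens_ind => [|x y Hx Hy|b u]; rewrite ?tens_mulx0 ?tens_mulDr ?Hx ?Hy //.
by rewrite tensM !mul1r.
Qed.

Fact tens_mulr1 : right_id (tens 1 1) tens_mul.
Proof.
elim/tens_ind => [|x y Hx Hy|b u]; rewrite ?tens_mul0x ?tens_mulDl ?Hx ?Hy //.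
by rewrite tensM !mulr1.
Qed.

HB.instance Definition _ := GRing.Zmodule_isPzRing.Build BE
  tens_mulA tens_mul1 tens_mulr1 tens_mulDl tens_mulDr.

Definition tens_in : E -> BE := tens 1.

Fact tens_in_zmod_morphism : zmod_morphism tens_in.
Proof.
by move=> u v; apply/rowP => l; rewrite !mxE linearB rmorphB mulrBl.
Qed.

Fact tens_in_monoid_morphism : monoid_morphism tens_in.
Proof. by split=> // u v; rewrite /tens_in [RHS]tensM mulr1. Qed.

HB.instance Definition _ :=
  GRing.isZmodMorphism.Build E BE tens_in tens_in_zmod_morphism.
HB.instance Definition _ :=
  GRing.isMonoidMorphism.Build E BE tens_in tens_in_monoid_morphism.

Fact tens_inC (u : E) (x : BE) : tens_in u * x = x * tens_in u.
Proof.
elim/tens_ind: x => [|x y Hx Hy|b v].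
- by rewrite mulr0 mul0r.
- by rewrite mulrDl mulrDr Hx Hy.
by rewrite [LHS]tensM [RHS]tensM mul1r mulr1 mulrC.
Qed.

Let entry_continuous i : continuous (fun x : BE => (x : 'rV[B]_n) 0 i).
Proof.
move=> x U /= xU; exists (fun _ j => if j == i then U else setT).
  move=> i' j; case: eqP => [->|_]; first by rewrite (ord1 i').
  exact: filterT.
by move=> y /(_ 0 i); rewrite eqxx.
Qed.

Let row_continuous (T : topologicalType) (f : T -> BE) :
  (forall i, continuous (fun t => (f t : 'rV[B]_n) 0 i)) -> continuous f.
Proof.
move=> fc t U [P fP PU].
have : \forall s \near t, forall j, P 0 j ((f s : 'rV[B]_n) 0 j).
  by apply: filter_forall => j; apply: fc; exact: fP.
by apply: filterS => s Hs; apply: PU => i j; rewrite (ord1 i).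
Qed.

Let fst_entry i : continuous (fun z : BE * BE => (z.1 : 'rV[B]_n) 0 i).
Proof.
move=> z; apply: (@continuous_comp _ _ _ fst (fun x : BE => (x : 'rV[B]_n) 0 i)).
  exact: cvg_fst.
exact: entry_continuous.
Qed.

Let snd_entry i : continuous (fun z : BE * BE => (z.2 : 'rV[B]_n) 0 i).
Proof.
move=> z; apply: (@continuous_comp _ _ _ snd (fun x : BE => (x : 'rV[B]_n) 0 i)).
  exact: cvg_snd.
exact: entry_continuous.
Qed.

Fact tens_add_continuous : continuous (fun z : BE * BE => z.1 + z.2).
Proof.
apply: row_continuous => i; under eq_fun do rewrite mxE.
exact: talg_continuousD.
Qed.

Fact tens_opp_continuous : continuous (-%R : BE -> BE).
Proof.
apply: row_continuous => i; under eq_fun do rewrite mxE.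
move=> x; apply: (@continuous_comp _ _ _ (fun x : BE => (x : 'rV[B]_n) 0 i)).
  exact: entry_continuous.
exact: opp_continuous.
Qed.

Fact tens_mul_continuous : continuous (fun z : BE * BE => z.1 * z.2).
Proof.
apply: row_continuous => l; under eq_fun do rewrite mxE.
apply: talg_continuous_sum => i; apply: talg_continuous_sum => j.
apply: talg_continuousM; first exact: cst_continuous.
exact: talg_continuousM.
Qed.

HB.instance Definition _ :=
  PreTopologicalNmodule_isTopologicalNmodule.Build BE tens_add_continuous.
HB.instance Definition _ :=
  TopologicalNmodule_isTopologicalZmodule.Build BE tens_opp_continuous.
HB.instance Definition _ :=
  isTopAlgebra.Build E BE tens_inC tens_mul_continuous.

Lemma tensE b u : tens b u = tens b 1 * talg_in u.
Proof. by rewrite [RHS]tensM mulr1 mul1r. Qed.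

Lemma baseChange_universal (C : topAlgType E) (f : {rmorphism B -> C}) :
  continuous f -> (forall c : k, f (talg_in c) = talg_in (c%:A : E)) ->
  exists! g : BE -> C, [/\ zmod_morphism g, monoid_morphism g, continuous g,
    forall u : E, g (talg_in u) = talg_in u & forall b, g (tens b 1) = f b].
Proof.
move=> fc fk; pose g (x : BE) := \sum_i f ((x : 'rV[B]_n) 0 i) * talg_in (e i) : C.
have gB : zmod_morphism g.
  move=> x y; rewrite /g -sumrB; apply: eq_bigr => i _.
  by rewrite !mxE rmorphB mulrBl.
have g0 : g 0 = 0 by rewrite -[X in g X](subrr 0) gB subrr.
have gD x y : g (x + y) = g x + g y.
  by rewrite -[y in LHS]opprK gB -[- y]sub0r gB g0 sub0r opprK.
have gT b u : g (tens b u) = f b * talg_in u.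
  rewrite {2}(coord_vbasis (memvf u)) rmorph_sum mulr_sumr; apply: eq_bigr => i _.
  by rewrite mxE rmorphM fk talg_inC -mulrA -rmorphM mulr_algl.
have gM x y : g (x * y) = g x * g y.
  elim/tens_ind: x => [|x x' Hx Hx'|b u]; first by rewrite mul0r g0 mul0r.
    by rewrite mulrDl !gD Hx Hx' mulrDl.
  elim/tens_ind: y => [|y y' Hy Hy'|c v]; first by rewrite mulr0 g0 mulr0.
    by rewrite mulrDr !gD Hy Hy' mulrDr.
  rewrite [X in g X]tensM !gT !rmorphM -!mulrA; congr (_ * _).
  by rewrite [RHS]mulrA [talg_in u * f c]talg_inC -mulrA.
exists g; split.
  split=> //.
  - by split; [rewrite gT !rmorph1 mulr1 | exact: gM].
  - apply: talg_continuous_sum => i; apply: talg_continuousM.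
      move=> x; apply: (@continuous_comp _ _ _ (fun x : BE => (x : 'rV[B]_n) 0 i) f).
        exact: entry_continuous.
      exact: fc.
    exact: cst_continuous.
  - by move=> u; rewrite gT rmorph1 mul1r.
  - by move=> b; rewrite gT rmorph1 mulr1.
move=> h [hB hM _ hE hf]; apply/funext => x.
have h0 : h 0 = 0 by rewrite -[X in h X](subrr 0) hB subrr.
elim/tens_ind: x => [|x y Hx Hy|b u]; first by rewrite g0 h0.
  have -> : h (x + y) = h x + h y.
    by rewrite -[y in LHS]opprK hB -[- y]sub0r hB h0 sub0r opprK.
  by rewrite gD Hx Hy.
by rewrite gT tensE hM.2 hf hE.
Qed.

End BaseChange.

Definition topologically_semisimple (k : fieldType) (B : topAlgType k) : Prop :=
  forall I : set B, closed I -> left_ideal I ->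
    exists L : set B, [/\ closed L, left_ideal L,
      forall b : B, exists x y, [/\ I x, L y & b = x + y]
    & I `&` L = [set 0]].

Definition separable (k : fieldType) (B : topAlgType k) : Prop :=
  forall E : fieldExtType k,
    @topologically_semisimple E (baseChange B E).

(* Main.v *)
Require Import Defs.
From HB Require Import structures.
From mathcomp Require Import all_boot all_algebra falgebra fieldext.
From mathcomp Require Import all_classical topology tvs.

Set Implicit Arguments.
Unset Strict Implicit.
Unset Printing Implicit Defensive.

Import GRing.Theory.
Local Open Scope ring_scope.

(** The section is found by shrinking closed subalgebras [C] of [A] with
    [C + J = A].  A chain of such subalgebras has an intersection of the same
    kind, since [A] is linearly compact ([linear_compactness]); let [C] be a
    minimal one ([minimal_supplement]).  It suffices that [C] meets [J] in [0]:
    the projection [C -> A / J] is then a bijective algebra morphism, and its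
    inverse is continuous because [C ∩ I + J] is open for every open ideal [I]
    ([supplement_open], again by linear compactness).

    If [C ∩ J] is not [0], it is not contained in some open ideal [I] of finite
    codimension.  Represent [A / I] by matrices and let [D] and [M] be the images
    of [C] and [C ∩ J].  The elements of [J] act by nilpotent matrices
    ([radical_nil]), so [M * M] is a proper subspace of [M]
    ([nil_square_proper]).  As [D / M] is separable, a form of Hochschild's
    vanishing of the second cohomology group gives a subalgebra [D'] of [D] with
    [D' + M = D] and [D' ∩ M] contained in [M * M] ([splitting_step]); its
    preimage in [C] is a smaller supplement ([shrink_supplement]), contradicting
    minimality.

    Separability enters through dual bases: families [x], [y] with
    [\sum_i x i * y i = 1] such that left multiplication on [x] and right
    multiplication on [y] by the same element have the same matrix, that is, the
    components of a separability idempotent [\sum_i x i ⊗ y i].  If [S] is the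
    quotient of [B = A / J] by an open ideal of finite codimension, semisimplicity
    of [B ⊗ E] makes [S ⊗ E] von Neumann regular ([rho_ext_regular]).  Among all finite extensions [E] of [k] and all families
    of orthogonal nonzero idempotents of sum [1] in [S ⊗ E], one of maximal
    length exists.  Each of its corners [e i * (S ⊗ E) * e i] is then [E * e i]:
    otherwise some element of a corner would acquire an eigenvalue over a larger
    extension, and regularity would yield an idempotent splitting [e i]
    ([refine_orth_idem]).  Matrix units between these corners give dual bases over
    [E] ([split_dual_bases]), and a [k]-linear retraction [E -> k] brings them
    down to [k] ([dual_bases_descent]).  No structure theorem for semisimple
    algebras is needed. *)

(** * Subspaces of finite-dimensional spaces *)

Section Subspaces.
Variables (k : fieldType) (V : vectType k).
Implicit Types (U : {vspace V}) (P : {vspace V} -> Prop).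

Lemma min_vspace P U0 : P U0 ->
  exists2 U, P U & forall U', P U' -> (U' <= U)%VS -> U' = U.
Proof.
move=> PU0; have ex : exists n, `[< exists2 U, P U & \dim U = n >].
  by exists (\dim U0); apply/asboolP; exists U0.
case: (ex_minnP ex) => n /asboolP[U PU dU] nmin; exists U => // U' PU' U'U.
apply/eqP; rewrite eqEdim U'U dU; apply: nmin; apply/asboolP; by exists U'.
Qed.

Lemma max_vspace P U0 : P U0 ->
  exists2 U, P U & forall U', P U' -> (U <= U')%VS -> U' = U.
Proof.
move=> PU0; have ex : exists n, `[< exists2 U, P U & \dim U = n >].
  by exists (\dim U0); apply/asboolP; exists U0.
have ub n : `[< exists2 U, P U & \dim U = n >] -> (n <= \dim {:V})%N.
  by move=> /asboolP[U _ <-]; exact: dimvS (subvf U).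
case: (ex_maxnP ex ub) => n /asboolP[U PU dU] nmax; exists U => // U' PU' UU'.
apply/esym/eqP; rewrite eqEdim UU' dU; apply: nmax; apply/asboolP; by exists U'.
Qed.

(** Subspaces arise below as sets of images under a representation. *)
Lemma vspace_of_set (W : V -> Prop) :
    W 0 -> (forall c u v, W u -> W v -> W (c *: u + v)) ->
  exists U, forall v, v \in U <-> W v.
Proof.
move=> W0 WD.
have [|U WU Umax] := @max_vspace (fun U => forall v, v \in U -> W v) 0%VS.
  by move=> v; rewrite memv0 => /eqP->.
exists U => v; split=> [/WU//|Wv].
rewrite -(Umax (U + <[v]>)%VS) ?addvSl //; first by rewrite memvE addvSr.
move=> _ /memv_addP[u /WU Wu [_ /vlineP[c ->] ->]].
by rewrite addrC; exact: WD.
Qed.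

End Subspaces.

(** * Splitting fields *)

Lemma irreducible_factor (F : fieldType) (p : {poly F}) : (1 < size p)%N ->
  exists2 r, r %| p & irreducible_poly r.
Proof.
move=> p1; pose Q n := `[< exists r : {poly F},
  [/\ r %| p, (1 < size r)%N & size r = n] >].
have ex : exists n, Q n by exists (size p); apply/asboolP; exists p.
case: (ex_minnP ex) => n /asboolP[r [rp r1 rn]] nmin; exists r => //.
split=> // q q1 qr; rewrite -dvdp_size_eqp // eqn_leq.
rewrite dvdp_leq ?rn ?nmin //; last by rewrite -size_poly_gt0 ltnW.
apply/asboolP; exists q; split=> //; first exact: dvdp_trans rp.
have q0 : size q != 0%N.
  rewrite size_poly_eq0; apply/eqP => q0; move: qr; rewrite q0 dvd0p => /eqP r0.
  by rewrite r0 size_poly0 in r1.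
by case: (size q) q0 q1 => [|[|]].
Qed.

Lemma splitting_extension (F : fieldType) (p : {poly F}) : p \is monic ->
  exists (L : fieldExtType F) (s : seq L),
    map_poly (in_alg L) p = \prod_(a <- s) ('X - a%:P).
Proof.
have [n] := ubnP (size p); elim: n => // n IHn in F p * => lepn mon_p.
have [p1|p1] := leqP (size p) 1.
  have /eqP -> : p == 1.
    rewrite -(eqp_monic mon_p (monic1 _)) -size_poly_eq1.
    by rewrite eqn_leq p1 size_poly_gt0 monic_neq0.
  by exists F^o, [::]; rewrite rmorph1 big_nil.
have [r r_p irr_r] := irreducible_factor p1.
have [K _ [x rx0 _]] := irredp_FAdjoin irr_r.
have /factor_theorem[q Dp] : root (map_poly (in_alg K) p) x.
  by rewrite -(divpK r_p) rmorphM rootM rx0 orbT.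
have mon_q : q \is monic.
  have := mon_p; rewrite -(map_monic (in_alg K)) Dp.
  by rewrite monicMr // monicXsubC.
have Dszp : size p = size (q * ('X - x%:P)) by rewrite -Dp size_map_poly.
have [] := IHn K q => //.
  by rewrite ltnS Dszp size_mul ?polyXsubC_eq0 ?size_XsubC ?addn2 ?monic_neq0 in lepn.
move=> L [s Dq]; exists (baseFieldType L), (x%:A :: s).
rewrite big_cons.
rewrite (eq_map_poly (g := in_alg L \o in_alg K)); last first.
  by move=> a; rewrite /= baseField_scaleE.
rewrite map_poly_comp Dp rmorphM rmorphB /= map_polyX map_polyC /= mulrC.
by congr (_ * _).
Qed.

(** * Scalar extension of spaces of matrices *)

Section ScalarExtension.
Variable n : nat.
Local Notation M := (fun F : fieldType => 'M[F]_n.+1).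

(** [extmx f U] is the [E]-span of the image of [U] under the field morphism [f];
    it stands for [U ⊗ E], with [E] acting by scalars on matrices. *)
Definition extmx (F E : fieldType) (f : {rmorphism F -> E})
    (U : {vspace M F}) : {vspace M E} :=
  <<[seq map_mx f v | v <- vbasis U]>>%VS.

Lemma extmx_ind (F E : fieldType) (f : {rmorphism F -> E}) (U : {vspace M F})
    (P : M E -> Prop) :
  P 0 -> (forall x y, P x -> P y -> P (x + y)) ->
  (forall c v, v \in U -> P (c *: map_mx f v)) ->
  forall x, x \in extmx f U -> P x.
Proof.
move=> P0 PD PZ x /coord_span ->.
elim/big_ind: _ => // i _.
have ilt : (i < size (vbasis U))%N by have := ltn_ord i; rewrite size_tuple.
by rewrite (nth_map 0) //; apply: PZ; apply/vbasis_mem/mem_nth.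
Qed.

Lemma mem_extmx (F E : fieldType) (f : {rmorphism F -> E}) (U : {vspace M F}) v :
  v \in U -> map_mx f v \in extmx f U.
Proof.
move=> /coord_vbasis ->; rewrite raddf_sum; apply: memv_suml => i _.
rewrite /= map_mxZ memvZ // memv_span // map_f // mem_nth // size_tuple.
exact: ltn_ord.
Qed.

Lemma extmxM (F E : fieldType) (f : {rmorphism F -> E}) (U : {vspace M F}) :
  {in U &, forall x y, x * y \in U} ->
  {in extmx f U &, forall x y, x * y \in extmx f U}.
Proof.
move=> UM x y xU yU.
elim/extmx_ind: x / xU => [|x x' Hx Hx'|c v vU]; rewrite ?mul0r ?mem0v //.
  by rewrite mulrDl memvD.
elim/extmx_ind: y / yU => [|y y' Hy Hy'|d w wU]; rewrite ?mulr0 ?mem0v //.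
  by rewrite mulrDr memvD.
rewrite -scalerAl -scalerAr !memvZ //.
by rewrite -[_ * _](map_mxM f) mem_extmx // UM.
Qed.

Lemma extmx_trans (F E L : fieldType) (f : {rmorphism F -> E})
    (g : {rmorphism E -> L}) (h : {rmorphism F -> L}) (U : {vspace M F}) x :
  h =1 g \o f -> x \in extmx f U -> map_mx g x \in extmx h U.
Proof.
move=> hgf xU; elim/extmx_ind: x / xU => [|x y Hx Hy|c v vU].
- by rewrite map_mx0 mem0v.
- by rewrite map_mxD memvD.
rewrite map_mxZ memvZ // -map_mx_comp -(eq_map_mx _ hgf); exact: mem_extmx.
Qed.

(** A linear form with value [1] at [1]: a retraction of [F -> E]. *)
Lemma field_retraction (F : fieldType) (E : fieldExtType F) :
  exists p : {linear E -> F^o}, p 1 = 1.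
Proof.
have f1 : free [tuple (1 : E)] by rewrite seq1_free oner_eq0.
exists (coord [tuple (1 : E)] ord0).
by have := coord_free ord0 ord0 f1; rewrite eqxx.
Qed.

Section Retraction.
Variables (F : fieldType) (E : fieldExtType F) (p : {linear E -> F^o}).
Local Notation f := (in_alg E).
Implicit Types (U : {vspace M F}).

(** The map [U ⊗ E -> U] induced by a linear form [p : E -> F], applied entrywise. *)
Definition retract (x : M E) : M F := map_mx (p : E -> F) x.

Lemma retractZ c (v : M F) : retract (c *: map_mx f v) = p c *: v.
Proof.
by apply/matrixP => i j; rewrite !mxE mulrC mulr_algl linearZ /= mulrC.
Qed.

Lemma retract0 : retract (0 : M E) = 0.
Proof. by apply/matrixP => i j; rewrite !mxE linear0. Qed.

Lemma retractD (x y : M E) : retract (x + y) = retract x + retract y.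
Proof. by apply/matrixP => i j; rewrite !mxE linearD. Qed.

Lemma retract_extmx U x : x \in extmx f U -> retract x \in U.
Proof.
move=> xU; elim/extmx_ind: x / xU => [|x y Hx Hy|c v vU].
- by rewrite retract0 mem0v.
- by rewrite retractD memvD.
by rewrite retractZ memvZ.
Qed.

Lemma retractMr (a : M F) (x : M E) :
  retract (x * map_mx f a) = retract x * a.
Proof.
apply/matrixP => i j; rewrite !mxE linear_sum; apply: eq_bigr => l _.
by rewrite !mxE mulrC mulr_algl linearZ /= mulrC.
Qed.

Lemma retractMl (a : M F) (x : M E) :
  retract (map_mx f a * x) = a * retract x.
Proof.
apply/matrixP => i j; rewrite !mxE linear_sum; apply: eq_bigr => l _.
by rewrite !mxE mulr_algl linearZ.
Qed.

Lemma retractK (v : M F) : p 1 = 1 -> retract (map_mx f v) = v.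
Proof. by move=> p1; rewrite -[map_mx f v]scale1r retractZ p1 scale1r. Qed.

End Retraction.
End ScalarExtension.

(** * Dual bases from orthogonal idempotents *)

Section DualBasis.
Variables (F : fieldType) (n : nat) (T : {vspace 'M[F]_n.+1}).
Implicit Types x y z a : 'M[F]_n.+1.

(** The form in which semisimplicity of an algebra of matrices is used. *)
Definition von_neumann_regular := {in T, forall y, exists2 u, u \in T & y * u * y = y}.

(** Nonzero pairwise orthogonal idempotents of sum [1]. *)
Definition orth_idem r (e : 'I_r -> 'M[F]_n.+1) :=
  [/\ forall i, e i \in T, forall i, e i != 0,
      forall i j, e i * e j = if i == j then e i else 0
    & \sum_i e i = 1].

(** The elements [x i] and [y i] are the components of a separability idempotent
    [\sum_i x i ⊗ y i] of [T]: for each [a], the identity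
    [\sum_i a * x i ⊗ y i = \sum_i x i ⊗ y i * a] is witnessed by a single matrix
    [c]. *)
Definition dual_bases r (x y : 'I_r -> 'M[F]_n.+1) :=
  [/\ forall i, x i \in T, forall i, y i \in T, \sum_i x i * y i = 1
    & {in T, forall a, exists c : 'I_r -> 'I_r -> F, forall i,
        a * x i = \sum_j c j i *: x j /\ y i * a = \sum_j c i j *: y j}].

Hypothesis TM : {in T &, forall x y, x * y \in T}.
Hypothesis Treg : von_neumann_regular.

(** Such idempotents are linearly independent. *)
Lemma orth_idem_bound r (e : 'I_r -> 'M[F]_n.+1) : orth_idem e ->
  (r <= n.+1 * n.+1)%N.
Proof.
case=> _ e0 eM _; have fe : free [tuple e i | i < r].
  apply/freeP => c; under eq_bigr do rewrite -tnth_nth tnth_mktuple.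
  move=> ce i; have : (\sum_j c j *: e j) * e i = 0 by rewrite ce mul0r.
  rewrite mulr_suml (bigD1 i) //= -scalerAl eM eqxx big1 ?addr0.
    by move/eqP; rewrite scaler_eq0 (negPf (e0 i)) orbF => /eqP.
  by move=> j /negPf ji; rewrite -scalerAl eM ji scaler0.
move: fe; rewrite /free size_tuple => /eqP <-.
by rewrite (leq_trans (dimvS (subvf _))) // dimvf /dim /= .
Qed.

Section Split.
Variables (r : nat) (e : 'I_r -> 'M[F]_n.+1).
Hypothesis eO : orth_idem e.
Hypothesis eS : forall i, {in T, forall x, exists c, e i * x * e i = c *: e i}.

Let eT i : e i \in T. Proof. by case: eO. Qed.
Let eI i : e i * e i = e i. Proof. by case: eO => _ _ /(_ i i); rewrite eqxx. Qed.

(* Linked indices belong to the same simple block. *)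
Let linked i j := `[< exists2 x, x \in T & e i * x * e j != 0 >].

(** A nonzero element of [e i * T * e j] is invertible on one side: regularity
    provides [u] with [t * u * t = t], and [t * e j * u * e i] is a scalar multiple
    of [e i]. *)
Let linkedP i j : linked i j -> exists x y,
  [/\ x \in T, y \in T, x = e i * x * e j, y = e j * y * e i & x * y = e i].
Proof.
move=> /asboolP[x xT t0]; set t := e i * x * e j in t0.
have tT : t \in T by rewrite !TM.
have te : t * e j = t by rewrite -mulrA eI.
have et : e i * t = t by rewrite !mulrA eI.
clearbody t.
have [u uT tut] := Treg tT.
have [c] := eS i (TM tT uT); rewrite mulrA et => Dc.
have tw : t * (e j * u * e i) = c *: e i by rewrite !mulrA te Dc.
have c0 : c != 0.
  apply: contraNneq t0 => c0.
  have -> : t = t * (e j * u * e i) * t by rewrite !mulrA te -[t * u * e i * t]mulrA et tut.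
  by rewrite tw c0 scale0r mul0r.
exists t, (c^-1 *: (e j * u * e i)); split=> //.
- by rewrite memvZ // !TM.
- by rewrite et te.
- by rewrite -scalerAr -scalerAl !mulrA eI -!mulrA eI.
by rewrite -scalerAr tw scalerA mulVf ?scale1r.
Qed.

Let linked_refl i : linked i i.
Proof.
apply/asboolP; exists (e i) => //; rewrite !eI.
by case: eO.
Qed.

Let linked_sym i j : linked i j -> linked j i.
Proof.
move=> /linkedP[x [y [xT yT Dx Dy xy]]]; apply/asboolP; exists y => //.
rewrite -Dy; apply/eqP => y0; have [_ /(_ i)/eqP + _ _] := eO; apply.
by rewrite -xy y0 mulr0.
Qed.

Let linked_trans i j l : linked i j -> linked j l -> linked i l.
Proof.
move=> /linkedP[x [y [xT yT Dx Dy xy]]] /linkedP[x' [y' [xT' yT' Dx' Dy' xy']]].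
apply/asboolP; exists (x * x'); first exact: TM.
apply/eqP => xx0.
have xe : x * e j = x by rewrite Dx -!mulrA eI.
have ex : e i * x = x by rewrite Dx !mulrA eI.
have x'e : x' * e l = x' by rewrite Dx' -!mulrA eI.
move: xx0; rewrite mulrA ex -mulrA x'e => xx0.
have [_ /(_ i)/eqP + _ _] := eO; case.
by rewrite -xy -xe -xy' mulrA xx0 !mul0r.
Qed.

(** If the corners are one-dimensional, choose a representative [rep i] in each
    class of linked indices; [x i] and [y i] are matrix units between [e i] and
    [e (rep i)]. *)
Lemma split_dual_bases : exists x y : 'I_r -> 'M[F]_n.+1, dual_bases x y.
Proof.
(* [choose] depends only on the extent of the predicate, so [rep] is constant on
   classes. *)
pose rep i := choose (linked i) i.
have link_rep i : linked i (rep i) by exact: chooseP (linked_refl i).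
have rep_eq i j : linked i j -> rep i = rep j.
  move=> ij; rewrite /rep (@eq_choose _ (linked i) (linked j)).
    by apply: choose_id (linked_refl j); exact: linked_sym.
  move=> l; apply/idP/idP => [il|jl]; last exact: linked_trans jl.
  exact: linked_trans (linked_sym ij) il.
have /choice[x /choice[y Hxy]] := fun i => linkedP (link_rep i).
exists x, y; split.
- by move=> i; have [] := Hxy i.
- by move=> i; have [] := Hxy i.
- have [_ _ _ <-] := eO; apply: eq_bigr => i _; by have [] := Hxy i.
move=> a aT.
have xe i : x i * e (rep i) = x i by have [_ _ -> _ _] := Hxy i; rewrite -!mulrA eI.
have ex i : e i * x i = x i by have [_ _ -> _ _] := Hxy i; rewrite !mulrA eI.
have ye i : y i * e i = y i by have [_ _ _ -> _] := Hxy i; rewrite -!mulrA eI.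
have ey i : e (rep i) * y i = y i by have [_ _ _ -> _] := Hxy i; rewrite !mulrA eI.
have xy i : x i * y i = e i by have [] := Hxy i.
have xT i : x i \in T by have [] := Hxy i.
have yT i : y i \in T by have [] := Hxy i.
have key i j : exists c, e j * a * x i = c *: x j /\ y j * a * e i = c *: y i.
  have [ae0|ae0] := eqVneq (e j * a * e i) 0.
    exists 0; rewrite !scale0r -{1}ex mulrA ae0 mul0r; split=> //.
    by rewrite -ey -ye -!mulrA [e j * _]mulrA ae0 !mulr0.
  have ji : rep j = rep i by apply: rep_eq; apply/asboolP; exists a.
  have [c] := eS (rep i) (TM (TM (yT j) aT) (xT i)).
  rewrite -[in RHS]ji => Dc.
  have {}Dc : y j * a * x i = c *: e (rep j).
    by rewrite -Dc -{1}ji !mulrA ey -!mulrA xe.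
  exists c; split.
    by rewrite -xy -!mulrA [y j * _]mulrA Dc -scalerAr xe.
  by rewrite -xy !mulrA Dc -scalerAl ji ey.
have /choice[c Hc] : forall i, exists c : 'I_r -> F, forall j,
    e j * a * x i = c j *: x j /\ y j * a * e i = c j *: y i.
  by move=> i; have [c ?] := choice (key i); exists c.
exists (fun j i => c i j) => i; split.
  have [_ _ _ s1] := eO; rewrite -[a]mul1r -s1 !mulr_suml; apply: eq_bigr => j _.
  by have [] := Hc i j.
have [_ _ _ s1] := eO; rewrite -[LHS]mulr1 -s1 mulr_sumr; apply: eq_bigr => j _.
by have [] := Hc j i.
Qed.

End Split.
End DualBasis.

(** * Refining idempotents over extensions, and descent of dual bases *)

Section Refine.
Variables (F : fieldType) (n : nat) (T : {vspace 'M[F]_n.+1}).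
Hypothesis TM : {in T &, forall x y, x * y \in T}.
Hypothesis Treg : von_neumann_regular T.

(** If a product of linear factors in [X] kills [d], some partial product applied
    to [d] is an eigenvector of [X]. *)
Lemma eigen_factor (X d : 'M[F]_n.+1) (s : seq F) :
    d != 0 -> horner_mx X (\prod_(a <- s) ('X - a%:P)) * d = 0 ->
  exists a p, horner_mx X p * d != 0 /\
    X * (horner_mx X p * d) = a *: (horner_mx X p * d).
Proof.
move=> d0; elim: s => [|a s IHs].
  by rewrite big_nil rmorph1 mul1r => /eqP; rewrite (negPf d0).
rewrite big_cons rmorphM -mulrA.
have [/IHs//|s0] := eqVneq (horner_mx X (\prod_(j <- s) ('X - j%:P)) * d) 0.
move=> as0; exists a, (\prod_(j <- s) ('X - j%:P)); split=> //.
move: as0; rewrite rmorphB /= horner_mx_X horner_mx_C mulrBl => /eqP.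
by rewrite subr_eq0 => /eqP ->; rewrite -mul_scalar_mx.
Qed.

(** An element of the corner of [e i] that is not a multiple of [e i] and whose
    characteristic polynomial splits lets [e i] be written as a sum of two
    orthogonal nonzero idempotents. *)
Lemma refine_orth_idem r (e : 'I_r -> 'M[F]_n.+1) i X s :
    orth_idem T e -> X \in T -> e i * X = X -> X * e i = X ->
    (forall c, X != c *: e i) -> char_poly X = \prod_(a <- s) ('X - a%:P) ->
  exists e' : 'I_r.+1 -> 'M[F]_n.+1, orth_idem T e'.
Proof.
move=> [eT e0 eM e1] XT eX Xe Xc DX; set d := e i.
have dd : d * d = d by rewrite /d eM eqxx.
have [a [p [z0 Xz]]] : exists a p, horner_mx X p * d != 0 /\
    X * (horner_mx X p * d) = a *: (horner_mx X p * d).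
  by apply: (@eigen_factor _ _ s); rewrite ?e0 // -DX Cayley_Hamilton mul0r.
have dz : d * (horner_mx X p * d) = horner_mx X p * d.
  have cXd : comm_mx d X by rewrite /comm_mx [d *m X]eX [X *m d]Xe.
  by rewrite mulrA [d * _](comm_mx_horner p cXd) -[LHS]mulrA dd.
set z := _ * d in z0 Xz dz; clearbody z; clear p.
pose y := X - a *: d.
have yz : y * z = 0 by rewrite mulrBl Xz -scalerAl dz subrr.
have y0 : y != 0 by rewrite subr_eq0.
have yT : y \in T by rewrite memvB ?memvZ ?eT.
have yd : y * d = y by rewrite mulrBl Xe -scalerAl dd.
have [u uT yuy] := Treg yT.
(* [u * y] generates the same left ideal as [y], and [y] has the zero divisor [z]
   in the corner, so [f] is an idempotent different from [0] and from [d]. *)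
pose f := d * u * y.
have fT : f \in T by rewrite !TM ?eT.
have fd : f * d = f by rewrite -mulrA yd.
have df : d * f = f by rewrite !mulrA dd.
have ff : f * f = f.
  by rewrite /f -!mulrA [y * (d * _)]mulrA yd [y * (u * _)]mulrA yuy.
have f0 : f != 0.
  by apply: contraNneq y0 => f0; rewrite -yuy -{1}yd -!mulrA [d * _]mulrA -/f f0 mulr0.
have fnd : f != d.
  by apply: contraNneq z0 => fd'; rewrite -dz -fd' -mulrA yz mulr0.
pose e' (j : 'I_r.+1) := if unlift ord0 j is Some j' then
  (if j' == i then d - f else e j') else f.
have e'0 : e' ord0 = f by rewrite /e' unlift_none.
have e'S j : e' (lift ord0 j) = if j == i then d - f else e j by rewrite /e' liftK.
have fe j : j != i -> f * e j = 0.
  by move=> ji; rewrite -fd -mulrA /d eM eq_sym (negPf ji) mulr0.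
have ef j : j != i -> e j * f = 0.
  by move=> ji; rewrite -df mulrA /d eM (negPf ji) mul0r.
exists e'; split.
- move=> j; case: (unliftP ord0 j) => [j'|] ->; rewrite ?e'0 ?e'S //.
  by case: (j' =P i) => _; rewrite ?memvB ?eT.
- move=> j; case: (unliftP ord0 j) => [j'|] ->; rewrite ?e'0 ?e'S //.
  by case: (j' =P i) => _; rewrite ?e0 // subr_eq0 eq_sym.
- move=> j l; case: (unliftP ord0 j) => [j'|] ->; case: (unliftP ord0 l) => [l'|] ->;
    rewrite ?e'0 ?e'S ?eqxx ?(inj_eq lift_inj) //.
  + have [jE|ji] := eqVneq j' i; have [lE|li] := eqVneq l' i; rewrite ?jE ?lE ?eqxx.
    * by rewrite mulrBl !mulrBr dd fd df ff subrr subr0.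
    * by rewrite eq_sym (negPf li) mulrBl fe // subr0 /d eM eq_sym (negPf li).
    * by rewrite (negPf ji) mulrBr ef // subr0 /d eM (negPf ji).
    * by rewrite eM.
  + by case: (eqVneq j' i) => [_|/ef ->//]; rewrite mulrBl df ff subrr.
  + by case: (eqVneq l' i) => [_|/fe ->//]; rewrite mulrBr fd ff subrr.
rewrite big_ord_recl e'0; under eq_bigr do rewrite e'S.
rewrite (bigD1 i) //= eqxx addrA subrKC -[RHS]e1 [RHS](bigD1 i) //=.
congr (_ + _); by apply: eq_bigr => j /negPf ->.
Qed.
End Refine.

Section Descent.
Variables (k : fieldType) (n : nat) (S : {vspace 'M[k]_n.+1}).
Hypothesis S1 : 1 \in S.
Hypothesis SM : {in S &, forall x y, x * y \in S}.
Hypothesis Sreg : forall E : fieldExtType k, von_neumann_regular (extmx (in_alg E) S).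

(** The element [e i * x * e i] acquires eigenvalues over a finite extension, which
    is again a finite extension of [k]. *)
Lemma refine_extension (E : fieldExtType k) r (e : 'I_r -> 'M[E]_n.+1) i x :
    orth_idem (extmx (in_alg E) S) e -> x \in extmx (in_alg E) S ->
    (forall c, e i * x * e i != c *: e i) ->
  exists (E' : fieldExtType k) (e' : 'I_r.+1 -> 'M[E']_n.+1),
    orth_idem (extmx (in_alg E') S) e'.
Proof.
move=> [eT e0 eM e1] xT xc; set X := e i * x * e i.
have [L [s Ds]] := splitting_extension (char_poly_monic X).
pose E' : fieldExtType k := baseFieldType L; exists E'.
pose g : {rmorphism E -> E'} := in_alg L.
have gg : in_alg E' =1 g \o in_alg E by move=> a; rewrite /= baseField_scaleE.
pose m (y : 'M[E]_n.+1) : 'M[E']_n.+1 := map_mx g y.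
have mM y z : m (y * z) = m y * m z by exact: map_mxM.
have mT y : y \in extmx (in_alg E) S -> m y \in extmx (in_alg E') S.
  by move=> yT; exact: extmx_trans gg yT.
have XT : X \in extmx (in_alg E) S by rewrite /X !(extmxM SM).
apply: (@refine_orth_idem _ _ _ (extmxM SM) (@Sreg E') r (m \o e) i (m X) s).
- split=> /=.
  + by move=> j; exact: mT.
  + by move=> j; rewrite map_mx_eq0.
  + by move=> j l; rewrite -mM eM; case: ifP => // _; exact: map_mx0.
  + by rewrite -(raddf_sum (map_mx g)) e1; exact: map_mx1.
- exact: mT.
- by rewrite /= -mM !mulrA eM eqxx.
- by rewrite /= -mM -mulrA eM eqxx.
- (* A scalar over [L] would retract to a scalar over [E]. *)
  move=> c; apply/eqP => mX; have [p p1] := field_retraction L.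
  have /eqP := xc (p c); apply.
  have := congr1 (retract p) mX.
  by rewrite /= retractZ retractK.
by rewrite -Ds /= map_char_poly.
Qed.

Lemma split_extension : exists (E : fieldExtType k) r (x y : 'I_r -> 'M[E]_n.+1),
  dual_bases (extmx (in_alg E) S) x y.
Proof.
pose Q r := `[< exists (E : fieldExtType k) (e : 'I_r -> 'M[E]_n.+1),
  orth_idem (extmx (in_alg E) S) e >].
have exQ : exists r, Q r.
  exists 1%N; apply/asboolP; exists k^o, (fun=> 1); split.
  - by move=> _; rewrite -[1](map_mx1 (in_alg k^o)) mem_extmx.
  - by move=> _; exact: oner_neq0.
  - by move=> i j; rewrite !ord1 mulr1.
  - by rewrite big_ord_recl big_ord0 addr0.
have ubQ r : Q r -> (r <= n.+1 * n.+1)%N.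
  by move=> /asboolP[E [e /orth_idem_bound]].
case: (ex_maxnP exQ ubQ) => r /asboolP[E [e eO]] rmax.
exists E, r; apply: (split_dual_bases (extmxM SM) (@Sreg E) eO) => i x xT.
apply: contrapT => /forallNP xc.
have [|E' [e' eO']] := refine_extension (i := i) eO xT.
  by move=> c; apply/eqP; exact: xc.
suff : (r.+1 <= r)%N by rewrite ltnn.
by apply: rmax; apply/asboolP; exists E', e'.
Qed.

Lemma free_map_basis (E : fieldExtType k) m (b : m.-tuple 'M[k]_n.+1) :
  free b -> free (map_tuple (map_mx (in_alg E)) b : seq 'M[E]_n.+1).
Proof.
move=> /freeP fb; apply/freeP => c c0 i; have [p p1] := field_retraction E.
(* The retraction is applied to the relation divided by its coefficient [c i]. *)
apply/eqP; apply: contraT => ci; rewrite -(oner_eq0 k) -p1 -(mulVf ci); apply/eqP.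
apply: (fb (fun j => p ((c i)^-1 * c j))).
move: c0 => /(congr1 (fun z => retract p ((c i)^-1 *: z))).
rewrite scaler0 retract0 => c0; apply: etrans c0; rewrite scaler_sumr.
rewrite (big_morph (retract p) (@retractD _ _ _ p) (retract0 n p)).
apply: eq_bigr => j _; rewrite (nth_map 0) ?size_tuple //.
by rewrite scalerA retractZ.
Qed.

(** The separability idempotent over [E] is rewritten as [\sum_s b s ⊗ Y s] for a
    basis [b] of [S] over [k]; its first components are defined over [k], and the
    entrywise retraction of the [Y s] gives the second ones. *)
Lemma dual_bases_descent (E : fieldExtType k) r (x y : 'I_r -> 'M[E]_n.+1) :
    dual_bases (extmx (in_alg E) S) x y ->
  exists q (x' y' : 'I_q -> 'M[k]_n.+1), dual_bases S x' y'.
Proof.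
move=> [xT yT xy1 dual]; have [p p1] := field_retraction E.
pose b := vbasis S; pose f := in_alg E.
pose mb : (\dim S).-tuple 'M[E]_n.+1 := map_tuple (map_mx f) b.
have mbE i : mb`_i = map_mx f b`_i.
  have [ib|ib] := ltnP i (size b); first by rewrite (nth_map 0).
  by rewrite !nth_default ?size_map // map_mx0.
have fmb : free mb by apply: free_map_basis; exact: basis_free (vbasisP S).
pose C s i : E := coord mb s (x i).
have xE i : x i = \sum_s C s i *: map_mx f b`_s.
  have /coord_span : x i \in <<mb>>%VS by exact: xT.
  by rewrite {1}/C => {1}->; apply: eq_bigr => s _; rewrite mbE.
pose Y s := \sum_i C s i *: y i.
exists (\dim S), (fun s => b`_s), (fun s => retract p (Y s)).
(* Left multiplication on [b] has entries [A a] in [k], hence so has right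
   multiplication on [Y]. *)
pose A (a : 'M[k]_n.+1) (t s : 'I_(\dim S)) : k := coord b t (a * b`_s).
have AE a (s : 'I_(\dim S)) : a \in S -> a * b`_s = \sum_t A a t s *: b`_t.
  by move=> aS; apply: coord_vbasis; rewrite SM // vbasis_mem // mem_nth // size_tuple.
have mM (z w : 'M[k]_n.+1) : map_mx f (z * w) = map_mx f z * map_mx f w.
  exact: map_mxM.
have YE a t : a \in S -> Y t * map_mx f a = \sum_s (A a t s)%:A *: Y s.
  move=> aS; have [c Hc] := dual _ (mem_extmx f aS).
  have cE j : \sum_i C t i * c i j = \sum_s C s j * (A a t s)%:A.
    have [ax _] := Hc j; transitivity (coord mb t (map_mx f a * x j)).
      by rewrite ax linear_sum; apply: eq_bigr => i _; rewrite linearZ /= mulrC.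
    rewrite xE mulr_sumr linear_sum; apply: eq_bigr => s _.
    rewrite -scalerAr linearZ /= -mM AE // raddf_sum linear_sum.
    congr (_ * _); rewrite (bigD1 t) //= map_mxZ -mbE linearZ /= coord_free // eqxx.
    rewrite big1 ?addr0; first by rewrite /f /= mulr1.
    move=> u ut; rewrite map_mxZ -mbE linearZ /= coord_free //.
    by rewrite (negPf ut) mulr0.
  rewrite mulr_suml (eq_bigr (fun i => \sum_j (C t i * c i j) *: y j)); last first.
    move=> i _; rewrite -scalerAl; have [_ ->] := Hc i.
    by rewrite scaler_sumr; apply: eq_bigr => j _; rewrite scalerA.
  rewrite exchange_big /=; under eq_bigr do rewrite -scaler_suml cE scaler_suml.
  rewrite exchange_big /=; apply: eq_bigr => s _; rewrite scaler_sumr.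
  by apply: eq_bigr => j _; rewrite scalerA mulrC.
have retZ (c : k) (z : 'M[E]_n.+1) : retract p (c%:A *: z) = c *: retract p z.
  by apply/matrixP => i j; rewrite !mxE mulr_algl linearZ.
have ret_sum := big_morph (retract p) (@retractD _ _ _ p) (retract0 n p).
split.
- by move=> s; rewrite vbasis_mem // mem_nth // size_tuple.
- move=> s; apply: retract_extmx; apply: memv_suml => i _; exact: memvZ.
- rewrite -[RHS](retractK (p := p) 1 p1) map_mx1 -[1%:M]xy1 ret_sum.
  under [RHS]eq_bigr do rewrite xE mulr_suml ret_sum.
  rewrite exchange_big /=; apply: eq_bigr => s _.
  rewrite /Y ret_sum mulr_sumr; apply: eq_bigr => i _.
  by rewrite -retractMl -scalerAl -scalerAr.
move=> a aS; exists (A a) => s; split; first exact: AE.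
by rewrite -retractMr YE // ret_sum; apply: eq_bigr => t _; rewrite retZ.
Qed.

Lemma universal_dual_bases : exists q (x y : 'I_q -> 'M[k]_n.+1), dual_bases S x y.
Proof.
by have [E [r [x [y /dual_bases_descent]]]] := split_extension.
Qed.

End Descent.

(** * Splitting off an ideal modulo its square *)

Section SplittingStep.
Variables (k : fieldType) (n : nat).
Local Notation Mx := 'M[k]_n.+1.
Variables (D M K : {vspace Mx}).
Hypothesis D1 : 1 \in D.
Hypothesis DM : {in D &, forall x y, x * y \in D}.
Hypothesis MD : {subset M <= D}.
Hypothesis DM_M : forall x y, x \in D -> y \in M -> x * y \in M.
Hypothesis MD_M : forall x y, x \in M -> y \in D -> x * y \in M.
Hypothesis MM_K : forall x y, x \in M -> y \in M -> x * y \in K.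
Hypothesis DK_K : forall x y, x \in D -> y \in K -> x * y \in K.
Hypothesis KD_K : forall x y, x \in K -> y \in D -> x * y \in K.

Variables (r : nat) (x y : 'I_r -> Mx).
Hypothesis xD : forall i, x i \in D.
Hypothesis yD : forall i, y i \in D.
Hypothesis xy1 : \sum_i x i * y i - 1 \in M.
Hypothesis dual : forall a, a \in D -> exists c : 'I_r -> 'I_r -> k, forall i,
  a * x i - \sum_j c j i *: x j \in M /\ y i * a - \sum_j c i j *: y j \in M.

(* A linear projection onto [M], which need not be a derivation; [phi] is its
   defect, a Hochschild cocycle of [D / M] with values in [M / K].  The dual bases
   express it as the coboundary of [g], so that [h] is a derivation modulo [K]. *)
Let p := projv M.
Let phi (a b : Mx) := a * p b - p (a * b) + p a * b.
Let g (b : Mx) := \sum_i x i * phi (y i) b.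
Let h (b : Mx) := p b - g b.

Let sum3D (V : zmodType) (a a' b b' c c' : V) :
  (a + a') + (- b - b') + (c + c') = (a - b + c) + (a' - b' + c').
Proof. by rewrite (addrACA a) [LHS]addrACA. Qed.

Let sum6_eq0 (V : zmodType) (t1 t2 t3 t4 t5 t6 : V) :
  (t1 - t2 + t3) - (t1 - t4 + t5) + (t2 - t4 + t6) - (t3 - t5 + t6) = 0.
Proof.
rewrite !opprD !opprK !addrA.
by rewrite [LHS](ACl ((1*4)*(7*2)*(3*10)*(5*8)*(11*6)*(9*12))) /= !subrr !addr0.
Qed.

(* The defect of [h] on a product, in terms of three differences that lie in [K].
   Here [P = p (a * b)], [G = g (a * b)], [ap = a * p b], [ag = a * g b],
   [pb = p a * b], [gb = g a * b]; [Y] and [Z] are the two sums that the cocycle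
   identity produces from [gb - G], and [X] is [ag] rewritten along the dual bases. *)
Let derivation_sum (V : zmodType) (P G ap ag pb gb X Y Z : V) : gb - G = Z - Y ->
  P - G - ((ap - ag) + (pb - gb)) = (ag - X) - (Y - X) + (Z - (ap - P + pb)).
Proof.
move=> H.
have -> : ag - X - (Y - X) = ag - Y by rewrite opprB addrA subrK.
have -> : ag - Y + (Z - (ap - P + pb)) = ag + (Z - Y) - (ap - P + pb).
  by rewrite !addrA [ag - Y + Z]addrAC.
by rewrite -H !opprD !opprK !addrA [RHS](ACl (5*3*4*1*6*2)).
Qed.

Let phiDl a a' b : phi (a + a') b = phi a b + phi a' b.
Proof. by rewrite /phi !mulrDl !linearD /= mulrDl sum3D. Qed.

Let phiZl c a b : phi (c *: a) b = c *: phi a b.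
Proof. by rewrite /phi -!scalerAl !linearZ /= -scalerAl !scalerDr !scalerN. Qed.

Let phiDr a b b' : phi a (b + b') = phi a b + phi a b'.
Proof. by rewrite /phi !mulrDr !linearD /= mulrDr sum3D. Qed.

Let phiZr c a b : phi a (c *: b) = c *: phi a b.
Proof. by rewrite /phi linearZ /= -!scalerAr linearZ /= !scalerDr !scalerN. Qed.

Let phi_sum (c : 'I_r -> k) z b :
  phi (z - \sum_j c j *: y j) b = phi z b - \sum_j c j *: phi (y j) b.
Proof.
rewrite phiDl -scaleN1r phiZl scaleN1r; congr (_ - _).
rewrite (big_morph (phi^~ b) (fun a a' => phiDl a a' b) (_ : _ = 0)).
  by apply: eq_bigr => j _; rewrite phiZl.
by rewrite -(scale0r (0 : Mx)) phiZl !scale0r.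
Qed.

Let phi_cocycle z a b :
  z * phi a b - phi (z * a) b + phi z (a * b) - phi z a * b = 0.
Proof.
by rewrite /phi !(mulrDr, mulrDl, mulrN, mulNr) !mulrA; exact: sum6_eq0.
Qed.

Let pM z : p z \in M. Proof. exact: memv_proj. Qed.
Let p_id z : z \in M -> p z = z. Proof. exact: projv_id. Qed.

Let phiM a b : a \in D -> b \in D -> phi a b \in M.
Proof.
move=> aD bD; apply: memvD; last exact: MD_M (pM a) bD.
by apply: memvB; [exact: DM_M aD (pM b) | exact: pM].
Qed.

Let phiMl m b : m \in M -> b \in D -> phi m b \in K.
Proof.
move=> mM bD; rewrite /phi (p_id mM) (p_id (MD_M mM bD)) subrK; exact: MM_K.
Qed.

Let phiMr a m : a \in D -> m \in M -> phi a m \in K.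
Proof.
move=> aD mM; rewrite /phi (p_id mM) (p_id (DM_M aD mM)) subrr add0r; exact: MM_K.
Qed.

Let g_in b : b \in D -> g b \in M.
Proof. by move=> bD; apply: memv_suml => i _; rewrite DM_M ?phiM. Qed.

Let h_in b : b \in D -> h b \in M.
Proof. by move=> bD; rewrite memvB ?g_in. Qed.

Let hM m : m \in M -> h m - m \in K.
Proof.
move=> mM; rewrite /h p_id // addrAC subrr add0r memvN.
by apply: memv_suml => i _; rewrite DK_K ?phiMr.
Qed.

Let h_der a b : a \in D -> b \in D -> h (a * b) - (a * h b + h a * b) \in K.
Proof.
move=> aD bD; have [c Hc] := dual aD.
have g1 : a * g b - \sum_i (\sum_j c j i *: x j) * phi (y i) b \in K.
  rewrite mulr_sumr -sumrB; apply: memv_suml => i _; rewrite mulrA -mulrBl.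
  by apply: MM_K; [have [] := Hc i | exact: phiM].
have g2 : \sum_i x i * phi (y i * a) b - \sum_i x i * \sum_j c i j *: phi (y j) b \in K.
  rewrite -sumrB; apply: memv_suml => i _; rewrite -mulrBr -phi_sum.
  by apply: DK_K => //; apply: phiMl => //; have [] := Hc i.
have g12 : \sum_i (\sum_j c j i *: x j) * phi (y i) b =
           \sum_i x i * \sum_j c i j *: phi (y j) b.
  under eq_bigr do rewrite mulr_suml.
  rewrite exchange_big /=; apply: eq_bigr => i _; rewrite mulr_sumr.
  by apply: eq_bigr => j _; rewrite -scalerAl -scalerAr.
have g3 : (\sum_i x i * y i) * phi a b - phi a b \in K.
  by rewrite -[X in _ - X]mul1r -mulrBl MM_K ?phiM.
have g4 : g a * b - g (a * b) =
   (\sum_i x i * y i) * phi a b - \sum_i x i * phi (y i * a) b.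
  rewrite !mulr_suml -!sumrB; apply: eq_bigr => i _.
  rewrite -!mulrA -!mulrBr; congr (_ * _).
  have /eqP := phi_cocycle (y i) a b.
  by rewrite -addrA addr_eq0 opprB => /eqP.
rewrite /h mulrBr mulrBl.
rewrite (@derivation_sum _ _ _ _ _ _ _ (\sum_i (\sum_j c j i *: x j) * phi (y i) b) _ _ g4).
by rewrite memvD // memvB // {1}g12.
Qed.

Let h_linear c u v : h (c *: u + v) = c *: h u + h v.
Proof.
rewrite /h linearP /= scalerBr addrACA -opprD; congr (_ - _).
rewrite /g scaler_sumr -big_split; apply: eq_bigr => i _ /=.
by rewrite phiDr phiZr mulrDr scalerAr.
Qed.

(** The subalgebra is the set of elements of [D] that [h] maps into [K]: since [h]
    is the identity on [M] modulo [K], it is a supplement of [M], and it meets [M]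
    inside [K]. *)
Lemma splitting_step : exists D' : {vspace Mx},
  [/\ {subset D' <= D}, 1 \in D', {in D' &, forall a b, a * b \in D'},
      forall d, d \in D -> exists2 m, m \in M & d - m \in D'
    & forall d, d \in D' -> d \in M -> d \in K].
Proof.
have [||D' HD'] := @vspace_of_set _ _ (fun d => d \in D /\ h d \in K).
- by split; rewrite ?mem0v // -[0](subrr 0) -scaleN1r addrC h_linear scaleN1r addNr mem0v.
- move=> c u v [uD uK] [vD vK]; rewrite memvD ?memvZ //; split=> //.
  by rewrite h_linear memvD ?memvZ.
exists D'; split.
- by move=> d /HD'[].
- apply/HD'; split=> //; have := h_der D1 D1; rewrite !mul1r mulr1.
  by rewrite opprD addrA subrr add0r memvN.
- move=> a b /HD'[aD aK] /HD'[bD bK]; apply/HD'; split; first exact: DM.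
  rewrite -(subrK (a * h b + h a * b) (h (a * b))) memvD ?h_der //.
  by apply: memvD; [exact: DK_K aD bK | exact: KD_K aK bD].
- move=> d dD; exists (h d); first exact: h_in.
  apply/HD'; split; first by rewrite memvB // MD // h_in.
  by rewrite -scaleN1r addrC h_linear scaleN1r addrC -opprB memvN hM ?h_in.
move=> d /HD'[_ dK] dM; have := hM dM.
by move=> dh; rewrite -(subKr (h d) d) memvB.
Qed.

End SplittingStep.

(** * Nil ideals *)

Section Nakayama.
Variables (k : fieldType) (n : nat).
Local Notation Mx := 'M[k]_n.+1.
Variables (D M : {vspace Mx}).
Hypothesis MD : {subset M <= D}.
Hypothesis DM_M : forall x y, x \in D -> y \in M -> x * y \in M.
Hypothesis M_nil : forall m, m \in M -> exists j, m ^+ j = 0.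

(** Nakayama's lemma: [M] acts trivially on a simple quotient of the left
    [D]-module [M]. *)
Lemma nil_square_proper : M != 0%VS -> exists2 m, m \in M & m \notin (M * M)%VS.
Proof.
move=> M0.
have [|W [WM WneM DW] Wmax] := @max_vspace _ _ (fun U => [/\ (U <= M)%VS, U <> M &
    forall d u, d \in D -> u \in U -> d * u \in U]) 0%VS.
  split; first exact: sub0v.
    by move=> E; rewrite -E eqxx in M0.
  by move=> d u _; rewrite !memv0 => /eqP->; rewrite mulr0.
suff MMW : (M * M <= W)%VS.
  apply: contrapT => H; apply: WneM; apply/eqP; rewrite eqEsubv WM /=.
  apply: subv_trans MMW; apply/subvP => m mM; apply: contrapT => mMM.
  by apply: H; exists m => //; exact/negP.
apply/prodvP => m w mM wM.
have [wW|wW] := boolP (w \in W); first by rewrite DW ?MD.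
have [||X HX] := @vspace_of_set _ _
    (fun x => exists m' w', [/\ m' \in M, w' \in W & x = m' * w + w']).
- by exists 0, 0; rewrite !mem0v mul0r addr0.
- move=> c u v [m1 [w1 [m1M w1W ->]]] [m2 [w2 [m2M w2W ->]]].
  exists (c *: m1 + m2), (c *: w1 + w2); rewrite !memvD ?memvZ //; split=> //.
  by rewrite scalerDr mulrDl -scalerAl addrACA.
have [XM|XM] := pselect (X = M).
  have /HX[m' [w' [m'M w'W Dw]]] : w \in X by rewrite XM.
  have [j mj] := M_nil m'M; case/negP: wW.
  (* Modulo [W], the element [w] is fixed by the nilpotent [m']. *)
  have : w - m' ^+ j * w \in W.
    elim: j {mj} => [|j IHj]; first by rewrite expr0 mul1r subrr mem0v.
    rewrite exprS -mulrA -[w in w - _](subrK (m' * w)) -addrA -mulrBr.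
    by rewrite memvD ?(DW m') ?MD // {1}Dw addrAC subrr add0r.
  by rewrite mj mul0r subr0.
have <- : X = W.
  apply: Wmax.
    split=> //.
      apply/subvP => x /HX[m' [w' [m'M w'W ->]]].
      by rewrite memvD ?DM_M ?MD // (subvP WM).
    move=> d u dD /HX[m' [w' [m'M w'W ->]]]; apply/HX.
    by exists (d * m'), (d * w'); rewrite mulrDr mulrA; split=> //;
      [exact: DM_M | exact: DW].
  by apply/subvP => x xW; apply/HX; exists 0, x; rewrite mem0v mul0r add0r.
by apply/HX; exists m, 0; rewrite mem0v addr0.
Qed.
End Nakayama.

(** * Matrix representations with a prescribed open kernel *)

Local Open Scope classical_set_scope.

Section TopologicalGroup.
Variable A : topologicalZmodType.
Implicit Types (I U : set A).

Lemma nbhs_translate (x : A) U : nbhs (0 : A) U -> nbhs x [set z | U (z - x)].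
Proof.
rewrite -{1}(subrr x) => xU.
have sh : (fun z => z - x) @ x --> x - x.
  apply: (@continuous_comp _ _ _ (fun z : A => (z, - x)) (fun z : A * A => z.1 + z.2)).
    by apply: cvg_pair => /=; [exact: cvg_id | exact: cvg_cst].
  exact: add_continuous.
exact: sh.
Qed.

Lemma open_subgroup_closed I : nbhs (0 : A) I -> (forall x y, I x -> I y -> I (x - y)) ->
  closed I.
Proof.
move=> I0 IB x clx; have [y [Iy Iyx]] := clx _ (nbhs_translate x I0).
by rewrite -(subKr y x); exact: IB.
Qed.

End TopologicalGroup.

Section Representation.
Variables (k : fieldType) (A : topAlgType k).
Implicit Types (I : set A).

Lemma ideal_sum I (n : nat) (F : 'I_n -> A) : left_ideal I ->
  (forall i, I (F i)) -> I (\sum_i F i).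
Proof. by move=> [I0 ID _] IF; elim/big_ind: _. Qed.

Lemma idealB I x y : left_ideal I -> I x -> I y -> I (x - y).
Proof. by move=> [_ ID IM] Ix Iy; apply: ID => //; rewrite -mulN1r; exact: IM. Qed.

Let subBB (a b c d : A) : (a - b) - (c - d) = (a - c) - (b - d).
Proof. by rewrite !opprB addrACA [RHS]addrACA [- b - c]addrC. Qed.

(** The regular representation of [A / I] in a basis of minimal length.  Properness
    of [I] guarantees a nonempty basis, hence matrices that form a nonzero ring. *)
Lemma ideal_rep I : two_sided_ideal I -> finite_codim I -> ~ I 1 ->
  exists n (rho : {rmorphism A -> 'M[k]_n.+1}),
    (forall c, rho (talg_in c) = c%:M) /\ forall x, rho x = 0 <-> I x.
Proof.
move=> [Il Ir] fI I1; have [I0 ID IM] := Il.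
pose P n := `[< exists v : 'I_n -> A, forall x : A,
    exists c : 'I_n -> k, I (x - \sum_i talg_in (c i) * v i) >].
have exP : exists n, P n by have [n H] := fI; exists n; apply/asboolP.
case: (ex_minnP exP) => -[|n] /asboolP[v vP] nmin.
  have [c] := vP 1; rewrite big_ord0 subr0 => /I1 [].
have indep (c : 'I_n.+1 -> k) : I (\sum_i talg_in (c i) * v i) -> c =1 fun=> 0.
  move=> Ic i; apply/eqP; apply: contraT => ci; suff /nmin : P n by rewrite ltnn.
  apply/asboolP; exists (fun j => v (lift i j)) => x; have [d Id] := vP x.
  exists (fun j => d (lift i j) - d i / c i * c (lift i j)).
  have := ID _ _ Id (IM (talg_in (d i / c i)) _ Ic).
  rewrite mulr_sumr -addrA -sumrN -big_split /= (bigD1_ord i) //=.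
  rewrite mulrA -rmorphM /= divfK // addNr add0r -sumrN.
  congr (I (_ + _)); apply: eq_bigr => j _.
  by rewrite rmorphB mulrBl opprB [in RHS]addrC [in RHS]rmorphM mulrA.
have [co coP] := choice vP.
have coU x d : I (x - \sum_i talg_in (d i) * v i) -> co x =1 d.
  move=> Id i; apply/eqP; rewrite -subr_eq0; apply/eqP.
  apply: (indep (fun i => co x i - d i)).
  have := idealB Il Id (coP x).
  rewrite opprB addrC addrA subrK -sumrB.
  by congr I; apply: eq_bigr => j _; rewrite rmorphB mulrBl.
pose rho (a : A) : 'M[k]_n.+1 := \matrix_(i, j) co (a * v j) i.
have rhoB : zmod_morphism rho.
  move=> a b; apply/matrixP => i j; rewrite !mxE.
  apply: (coU _ (fun i => co (a * v j) i - co (b * v j) i)).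
  have := idealB Il (coP (a * v j)) (coP (b * v j)).
  rewrite subBB -mulrBl -sumrB.
  by congr (I (_ - _)); apply: eq_bigr => l _; rewrite rmorphB mulrBl.
have rho_in c : rho (talg_in c) = c%:M.
  apply/matrixP => i j; rewrite !mxE; apply: (coU _ (fun i => c *+ (i == j))).
  rewrite (bigD1 j) //= eqxx big1 ?addr0 ?subrr // => l /negPf->.
  by rewrite mulr0n rmorph0 mul0r.
have rhoM : monoid_morphism rho.
  split=> [|a b]; first by rewrite -(rmorph1 (talg_in : k -> A)) rho_in.
  apply/matrixP => i j; rewrite !mxE; under [RHS]eq_bigr do rewrite !mxE.
  apply: (coU _ (fun i => \sum_l co (a * v l) i * co (b * v j) l)) => //.
  have J1 := IM a _ (coP (b * v j)).
  have J2 : I (\sum_l talg_in (co (b * v j) l) *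
                (a * v l - \sum_i talg_in (co (a * v l) i) * v i)).
    by apply: ideal_sum => // l; apply: IM.
  have := ID _ _ J1 J2; rewrite mulrBr mulrA.
  under [X in _ - _ + X]eq_bigr do rewrite mulrBr.
  rewrite sumrB mulr_sumr addrA; congr (I (_ - _)).
    rewrite -[RHS]addr0 -addrA; congr (_ + _); apply/eqP; rewrite addrC subr_eq0; apply/eqP.
    by apply: eq_bigr => l _; rewrite !mulrA talg_inC.
  under eq_bigr do rewrite mulr_sumr.
  rewrite exchange_big /=; apply: eq_bigr => l _; rewrite rmorph_sum mulr_suml.
  by apply: eq_bigr => i' _; rewrite mulrA -rmorphM mulrC.
pose f : {rmorphism A -> 'M[k]_n.+1} := HB.pack rho
  (GRing.isZmodMorphism.Build _ _ rho rhoB) (GRing.isMonoidMorphism.Build _ _ rho rhoM).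
exists n, f; split=> // x; split=> [/matrixP r0|Ix].
  have xv j : I (x * v j).
    have := coP (x * v j); rewrite big1 ?subr0 // => i _.
    by have := r0 i j; rewrite !mxE => ->; rewrite rmorph0 mul0r.
  have /(IM x) := coP 1; rewrite mulrBr mulr1 => Ix.
  rewrite -(subrK (x * (\sum_i talg_in (co 1 i) * v i)) x); apply: ID => //.
  rewrite mulr_sumr; apply: ideal_sum => // i.
  by rewrite mulrA -talg_inC -mulrA; exact: IM.
apply/matrixP => i j; rewrite !mxE; apply: (coU _ (fun=> 0)).
by rewrite big1 ?subr0; [exact: Ir | move=> l _; rewrite rmorph0 mul0r].
Qed.

(** Without properness of [I] only a linear map with kernel [I] remains. *)
Lemma ideal_linear_rep I : two_sided_ideal I -> finite_codim I ->
  exists n (rho : {additive A -> 'M[k]_n.+1}),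
    (forall c x, rho (talg_in c * x) = c *: rho x) /\ forall x, rho x = 0 <-> I x.
Proof.
move=> Il fI; have [I1|I1] := pselect (I 1).
  pose z (x : A) : 'M[k]_1 := 0.
  have zB : zmod_morphism z by move=> x y; rewrite /z subr0.
  pose f : {additive A -> 'M[k]_1} :=
    HB.pack z (GRing.isZmodMorphism.Build _ _ z zB).
  exists 0%N, f.
  split=> [c x|x]; first by rewrite /= /z scaler0.
  by split=> // _; rewrite -[x]mulr1; have [[_ _ IM] _] := Il; exact: IM.
have [n [rho [rho_in rhoP]]] := ideal_rep Il fI I1.
have rhoZ c x : rho (talg_in c * x) = c *: rho x.
  by rewrite rmorphM rho_in -mul_scalar_mx.
by exists n, rho.
Qed.

End Representation.

(** * Linear compactness *)

(** A nonempty translate of a linear subspace. *)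
Definition affine_set (k : fieldType) (A : topAlgType k) (W : set A) :=
  (exists w, W w) /\
  forall (c : k) x y z, W x -> W y -> W z -> W (x + talg_in c * (y - z)).

Section LinearCompactness.
Variables (k : fieldType) (A : pseudocompactAlgType k).
Implicit Types (W V U I : set A) (F G : set (set A)).

(** Directed for reverse inclusion. *)
Definition downward G := forall V W, G V -> G W -> exists2 U, G U & U `<=` V `&` W.

(** The coset of [I] is that of a point of a member [W] whose image modulo [I] has
    minimal direction: smaller members have the same image as [W]. *)
Lemma coset_meeting_all G I : (forall W, G W -> affine_set W) ->
    downward G -> (exists W, G W) -> two_sided_ideal I -> finite_codim I ->
  exists2 a, exists2 W, G W & W a &
    forall V, G V -> exists x, V x /\ I (x - a).
Proof.
move=> Gaff Gdown [W0 GW0] Iid fI.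
have [n [rho [rhoZ rhoP]]] := ideal_linear_rep Iid fI.
pose dir W (U : {vspace 'M[k]_n.+1}) :=
  forall u, u \in U <-> exists x y, [/\ W x, W y & u = rho (x - y)].
have dirP W : G W -> exists Y : {vspace 'M[k]_n.+1}, dir W Y.
  move=> /Gaff[[w Ww] Waff]; apply: vspace_of_set.
    by exists w, w; rewrite subrr raddf0.
  move=> c _ _ [x [y [Wx Wy ->]]] [z [t [Wz Wt ->]]].
  exists (z + talg_in c * (x - y)), t; split=> //; first exact: Waff.
  by rewrite [in RHS]addrAC [in RHS]raddfD rhoZ [LHS]addrC.
have [U0 dU0] := dirP _ GW0.
have [|U [W GW dU] Umin] := @min_vspace _ _ (fun Y => exists2 W, G W & dir W Y) U0.
  by exists W0.
have [[a Wa] _] := Gaff _ GW; exists a; first by exists W.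
move=> V GV; have [X GX XVW] := Gdown _ _ GV GW.
have [UX dX] := dirP _ GX.
have EU : UX = U.
  apply: Umin; first by exists X.
  apply/subvP => u /dX[x [y [Xx Xy ->]]]; apply/dU.
  by exists x, y; have [_ Wx] := XVW _ Xx; have [_ Wy] := XVW _ Xy.
have [[x Xx] Xaff] := Gaff _ GX.
have : rho (a - x) \in UX.
  by rewrite EU; apply/dU; exists a, x; have [_ Wx] := XVW _ Xx.
move=> /dX[y [z [Xy Xz E]]].
(* [x + (y - z)] lies in the affine set [X] and is congruent to [a]. *)
exists (x + talg_in 1 * (y - z)); split; first by have [] := XVW _ (Xaff 1 _ _ _ Xx Xy Xz).
rewrite rmorph1 mul1r; apply/rhoP.
by rewrite raddfB raddfD -E raddfB subrKC subrr.
Qed.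

(** A maximal downward directed family of affine sets containing [G0] has members
    inside a coset of each open ideal of finite codimension, so it generates a
    Cauchy filter, whose limit lies in every closed member. *)
Lemma linear_compactness (G0 : set (set A)) : (exists W, G0 W) ->
    (forall W, G0 W -> affine_set W /\ closed W) -> downward G0 ->
  exists a, forall W, G0 W -> W a.
Proof.
move=> G0n G0ac G0d.
pose P F := (forall W, (F `|` G0) W -> affine_set W) /\ downward (F `|` G0).
have [F [[Faff Fdown] Fmax]] : exists F, P F /\ forall F', F `<` F' -> ~ P F'.
  apply: Zorn_bigcup => C CP Ctot; split.
    move=> W [[F CF FW]|/G0ac[]//]; have [Faff _] := CP _ CF.
    by apply: Faff; left.
  have sub F : C F -> (F `|` G0) `<=` ((\bigcup_(X in C) X) `|` G0).
    by move=> CF W [FW|GW]; [left; exists F | right].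
  have one F V W : C F -> (F `|` G0) V -> (F `|` G0) W ->
      exists2 U, ((\bigcup_(X in C) X) `|` G0) U & U `<=` V `&` W.
    move=> CF FV FW; have [_ Fd] := CP _ CF; have [U FU UVW] := Fd _ _ FV FW.
    by exists U => //; exact: sub FU.
  move=> V W [[F CF FV]|GV] [[F' CF' FW]|GW].
  - case: (Ctot _ _ CF CF') => sFF.
      by apply: (one F') => //; left => //; exact: sFF.
    by apply: (one F) => //; left => //; exact: sFF.
  - by apply: (one F) => //; [left | right].
  - by apply: (one F') => //; [right | left].
  - by have [U GU UVW] := G0d _ _ GV GW; exists U => //; right.
pose G := F `|` G0.
have Gn : exists W, G W by have [W GW] := G0n; exists W; right.
have [B [BI BU _]] := @pc_basis k A.
have small I : B I -> exists a, exists2 W, G W & forall x, W x -> I (x - a).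
  move=> IB; have [Iid _ fI] := BI _ IB; have [Il _] := Iid; have [I0 ID IM] := Il.
  have [a [W GW Wa] aV] := coset_meeting_all Faff Fdown Gn Iid fI.
  (* Intersecting all members with the coset of [a] keeps the family admissible. *)
  pose F' := G `|` [set V | exists2 V', G V' & V = V' `&` [set x | I (x - a)]].
  have FF' : F `<=` F' by move=> V FV; left; left.
  have F'G0 : F' `|` G0 `<=` F' by move=> V [//|GV]; left; right.
  have PF' : P F'.
    split=> [V /F'G0|V V' /F'G0 FV /F'G0 FV'].
      case=> [/Faff//|[V' GV' ->]]; split.
        by have [x [V'x Ix]] := aV _ GV'; exists x.
      move=> c x y z [V'x Ix] [V'y Iy] [V'z Iz]; split.
        by have [_ V'aff] := Faff _ GV'; exact: V'aff.
      rewrite /= addrAC; apply: ID => //; apply: IM.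
      by have := idealB Il Iy Iz; rewrite opprB addrA subrK.
    have [X [GX XV]] : exists X, G X /\ (X `<=` V \/ X `&` [set x | I (x - a)] `<=` V).
      case: FV => [GV|[X GX ->]]; first by exists V; split=> //; left.
      by exists X; split=> //; right.
    have [X' [GX' XV']] : exists X, G X /\ (X `<=` V' \/ X `&` [set x | I (x - a)] `<=` V').
      case: FV' => [GV'|[X' GX' ->]]; first by exists V'; split=> //; left.
      by exists X'; split=> //; right.
    have [Y GY YXX] := Fdown _ _ GX GX'.
    exists (Y `&` [set x | I (x - a)]); first by left; right; exists Y.
    move=> x [Yx Ix]; have [Xx X'x] := YXX _ Yx.
    by split; [case: XV | case: XV'] => H; apply: H.
  have F'F : F' `<=` F.
    by apply: contrapT => nF'F; apply: (Fmax F').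
  exists a, (W `&` [set x | I (x - a)]); last by move=> x [].
  by left; apply: F'F; right; exists W.
pose Fl := filter_from G id.
have Flp : ProperFilter Fl.
  apply: filter_from_proper; last by move=> V /Faff[].
  apply: filter_from_filter => [//|V W GV GW].
  by have [U GU UVW] := Fdown _ _ GV GW; exists U.
have [|a Fla] := @pc_complete k A Fl.
  move=> U /BU[I IB IU]; have [a [W GW WI]] := small _ IB.
  exists W; first by exists W.
  move=> x y Wx Wy; apply: IU; have [[Il _] _ _] := BI _ IB.
  have := idealB Il (WI _ Wx) (WI _ Wy).
  by rewrite opprB addrA subrK.
exists a => W G0W; have [_ cW] := G0ac _ G0W; apply: cW => X aX.
have [V GV VX] := Fla _ aX.
have [Y GY YVW] := Fdown _ _ GV (or_intror G0W).
have [[y Yy] _] := Faff _ GY; exists y; have [Vy Wy] := YVW _ Yy.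
by split=> //; exact: VX.
Qed.

End LinearCompactness.

(** * The radical acts by nilpotent matrices *)

Section RadicalNil.
Variables (k : fieldType) (A : pseudocompactAlgType k) (n : nat).
Variable rho : {rmorphism A -> 'M[k]_n.+1}.
Hypothesis rho_in : forall c, rho (talg_in c) = c%:M.
Hypothesis rho_open : nbhs (0 : A) [set x | rho x = 0].

Let rhoZ c x : rho (talg_in c * x) = c *: rho x.
Proof. by rewrite rmorphM rho_in -mul_scalar_mx. Qed.

(** Otherwise the left ideal generated by [1 - x] and the kernel of [rho] would
    lie in a maximal left ideal, which is open, hence closed, and contains [x]. *)
Lemma radical_left_inverse x : jacobson A x -> exists b, rho b * (1 - rho x) = 1.
Proof.
move=> Jx; apply: contrapT => /forallNP noinv.
have [||U0 dU0] := @vspace_of_set _ _ (fun u => exists b, u = rho b * (1 - rho x)).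
- by exists 0; rewrite rmorph0 mul0r.
- move=> c _ _ [a ->] [b ->]; exists (talg_in c * a + b).
  by rewrite rmorphD rhoZ mulrDl scalerAl.
pose P (U : {vspace 'M[k]_n.+1}) :=
  [/\ forall a u, u \in U -> rho a * u \in U, 1 \notin U, 1 - rho x \in U &
      forall u, u \in U -> exists a, u = rho a].
have [|U [UM U1 Ux Ur] Umax] := @max_vspace _ _ P U0.
  split.
  - by move=> a u /dU0[b ->]; apply/dU0; exists (a * b); rewrite rmorphM mulrA.
  - by apply/negP => /dU0[b /esym]; exact: noinv.
  - by apply/dU0; exists 1; rewrite rmorph1 mul1r.
  - by move=> u /dU0[b ->]; exists (b * (1 - x)); rewrite rmorphM rmorphB rmorph1.
pose M := [set a | rho a \in U].
have Ml : left_ideal M.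
  split; rewrite /M /=; first by rewrite rmorph0 mem0v.
    by move=> a b aU bU; rewrite rmorphD memvD.
  by move=> a b bU; rewrite rmorphM UM.
suff /Jx Mx : maximal_closed_left_ideal M.
  by case/negP: U1; rewrite -(subrK (rho x) 1) memvD.
split=> //.
- apply: open_subgroup_closed; last by move=> a b; exact: idealB.
  by apply: filterS rho_open => a /= a0; rewrite /M /= a0 mem0v.
- move=> MT; have : M 1 by rewrite MT.
  by rewrite /M /= rmorph1 (negPf U1).
move=> N Nc Nl NT MN; have [N0 ND NM] := Nl.
have [||U' dU'] := @vspace_of_set _ _ (fun u => exists2 b, N b & u = rho b).
- by exists 0; rewrite ?rmorph0.
- move=> c _ _ [a Na ->] [b Nb ->]; exists (talg_in c * a + b).
    by apply: ND => //; exact: NM.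
  by rewrite rmorphD rhoZ.
have UU' : (U <= U')%VS.
  apply/subvP => u uU; have [a Ea] := Ur _ uU; apply/dU'; exists a => //.
  by apply: MN; rewrite /M /= -Ea.
have EU : U' = U.
  apply: Umax => //; split.
  - by move=> a u /dU'[b Nb ->]; apply/dU'; exists (a * b); [exact: NM | rewrite rmorphM].
  - apply/negP => /dU'[b Nb E]; apply: NT; rewrite eqEsubset; split=> // a _.
    rewrite -[a]mulr1; apply: NM; rewrite -(subrK b 1); apply: ND => //; apply: MN.
    by rewrite /M /= rmorphB rmorph1 -E subrr mem0v.
  - exact: subvP UU' _ Ux.
  - by move=> u /dU'[b Nb ->]; exists b.
rewrite eqEsubset; split=> // a Na; rewrite /M /= -EU; apply/dU'; by exists a.
Qed.

(** The image of [rho] is closed under polynomial expressions. *)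
Lemma horner_rep x (p : {poly k}) : exists y, horner_mx (rho x) p = rho y.
Proof.
elim/poly_ind: p => [|p c [y Hy]]; first by exists 0; rewrite !rmorph0.
exists (y * x + talg_in c).
by rewrite rmorphD rmorphM /= horner_mx_X horner_mx_C Hy rmorphD rmorphM rho_in.
Qed.

(** Write the characteristic polynomial as ['X ^+ m] times a polynomial [q] with
    nonzero constant term: [q] evaluated at [rho x] is a scalar times [1 - rho x']
    with [x'] in the radical, hence left invertible. *)
Lemma radical_nil x : jacobson A x -> exists j, rho x ^+ j = 0.
Proof.
move=> Jx; set X := rho x; have [[_ _ JM] _] := jacobson_two_sided A.
have [m [q nq Dq]] := multiplicity_XsubC (char_poly X) 0; exists m.
have {nq} q0 : q.[0] != 0 by move: nq; rewrite monic_neq0 ?char_poly_monic.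
have /factor_theorem[s Ds] : root (q - q.[0]%:P) 0.
  by rewrite /root !hornerE subrr.
have [y Hy] := horner_rep x s.
have [b] : exists b, rho b * (1 - rho (talg_in (- q.[0]^-1) * y * x)) = 1.
  by apply: radical_left_inverse; exact: JM.
rewrite rmorphM rhoZ -Hy -/X => Hb.
have qX : horner_mx X q = q.[0] *: (1 - (- q.[0]^-1 *: horner_mx X s) * X).
  rewrite -[in LHS](subrK q.[0]%:P q) Ds subr0 rmorphD rmorphM /= horner_mx_X horner_mx_C.
  rewrite scalerBr -scalerAl scalerA mulrN divff // scaleN1r opprK addrC.
  by rewrite -scalemx1.
have := Cayley_Hamilton X; rewrite Dq rmorphM rmorphXn /= subr0 horner_mx_X qX.
move=> /(congr1 (fun z => rho b * (q.[0]^-1 *: z))).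
by rewrite -scalerAl scalerA mulVf // scale1r mulrA Hb mul1r scaler0 mulr0.
Qed.

End RadicalNil.

(** * Matrix images of separable algebras *)

Section SeparableImage.
Variables (k : fieldType) (B : topAlgType k) (n : nat).
Variable rho : {rmorphism B -> 'M[k]_n.+1}.
Hypothesis rho_in : forall c, rho (talg_in c) = c%:M.
Hypothesis rho_open : nbhs (0 : B) [set x | rho x = 0].

Section Extension.
Variable E : fieldExtType k.
Local Notation BE := (baseChange B E).
Local Notation e := (fun i : 'I_(\dim {:E}) => (vbasis {:E})`_i).

(** The extension of [rho] to [B ⊗ E], in the coordinates that define [baseChange]. *)
Definition rho_ext (z : BE) : 'M[E]_n.+1 :=
  \sum_i e i *: map_mx (in_alg E) (rho ((z : 'rV[B]_(\dim {:E})) 0 i)).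

Lemma rho_extB : zmod_morphism rho_ext.
Proof.
move=> x y; rewrite /rho_ext -sumrB; apply: eq_bigr => i _.
by rewrite !mxE rmorphB map_mxB scalerBr.
Qed.

Lemma rho_ext0 : rho_ext 0 = 0.
Proof. by rewrite -[X in rho_ext X](subrr 0) rho_extB subrr. Qed.

Lemma rho_extD x y : rho_ext (x + y) = rho_ext x + rho_ext y.
Proof. by rewrite -[y in LHS]opprK rho_extB -[- y]sub0r rho_extB rho_ext0 sub0r opprK. Qed.

Lemma rho_ext_tens b u : rho_ext (tens b u) = u *: map_mx (in_alg E) (rho b).
Proof.
rewrite {2}(coord_vbasis (memvf u)) scaler_suml; apply: eq_bigr => i _.
rewrite !mxE rmorphM rho_in [_%:M * _]mul_scalar_mx map_mxZ scalerA /=.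
by rewrite mulr_algr.
Qed.

Lemma rho_extM x y : rho_ext (x * y) = rho_ext x * rho_ext y.
Proof.
elim/tens_ind: x => [|x x' Hx Hx'|b u]; first by rewrite mul0r rho_ext0 mul0r.
  by rewrite mulrDl !rho_extD Hx Hx' mulrDl.
elim/tens_ind: y => [|y y' Hy Hy'|c v]; first by rewrite mulr0 rho_ext0 mulr0.
  by rewrite mulrDr !rho_extD Hy Hy' mulrDr.
rewrite [X in rho_ext X]tensM !rho_ext_tens rmorphM -scalerAl -scalerAr scalerA.
by congr (_ *: _); exact: map_mxM.
Qed.

Lemma rho_ext_open : nbhs (0 : BE) [set z | rho_ext z = 0].
Proof.
have : nbhs (0 : BE) [set z : BE | forall i, rho ((z : 'rV[B]_(\dim {:E})) 0 i) = 0].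
  exists (fun _ _ => [set x | rho x = 0]).
    by move=> i j; rewrite mxE.
  by move=> z H i; exact: H.
apply: filterS => z z0; rewrite /rho_ext /= big1 // => i _.
by rewrite z0 map_mx0 scaler0.
Qed.

(** A complement of the open left ideal generated by [y] and the kernel of
    [rho_ext] provides an idempotent generator of that ideal modulo the kernel. *)
Lemma rho_ext_regular (S : {vspace 'M[k]_n.+1}) :
    (forall u, u \in S <-> exists b, u = rho b) -> topologically_semisimple BE ->
  von_neumann_regular (extmx (in_alg E) S).
Proof.
move=> dS ssB.
have im z : rho_ext z \in extmx (in_alg E) S.
  by apply: memv_suml => i _; rewrite memvZ // mem_extmx //; apply/dS; eexists.
have surj u : u \in extmx (in_alg E) S -> exists z, rho_ext z = u.
  move=> uS; elim/extmx_ind: u / uS => [|u v [x <-] [y <-]|c v /dS[b ->]].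
  - by exists 0; exact: rho_ext0.
  - by exists (x + y); exact: rho_extD.
  - by exists (tens b c); exact: rho_ext_tens.
move=> _ /surj[y <-].
pose I := [set z | exists u, rho_ext z = rho_ext (u * y)].
have Il : left_ideal I.
  split; first by exists 0; rewrite mul0r.
    by move=> x z [u xu] [v zv]; exists (u + v); rewrite mulrDl !rho_extD xu zv.
  by move=> a x [u xu]; exists (a * u); rewrite -mulrA !rho_extM xu rho_extM.
have Ic : closed I.
  apply: open_subgroup_closed; last by move=> a b; exact: idealB.
  by apply: filterS rho_ext_open => z /= z0; exists 0; rewrite mul0r z0 rho_ext0.
have [L [_ Ll IL IL0]] := ssB I Ic Il.
have [i [l [Ii Ll1 E1]]] := IL 1.
have [_ _ LM] := Ll; have [_ _ IM] := Il.
have Iy : I y by exists 1; rewrite mul1r.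
have yl : y * l = 0.
  have : (I `&` L) (y * l).
    split; last exact: LM.
    have -> : y * l = y - y * i by rewrite -[y in y - _]mulr1 E1 mulrDr addrC addKr.
    by apply: idealB => //; exact: IM.
  by rewrite IL0.
have yi : y * i = y by rewrite -[RHS]mulr1 E1 mulrDr yl addr0.
have [u iu] := Ii; exists (rho_ext u); first exact: im.
by rewrite -mulrA -rho_extM -iu -rho_extM yi.
Qed.

End Extension.

(** The dual bases of the image of [rho], lifted to [B]. *)
Lemma separable_image_dual_bases : separable B ->
  exists q (x y : 'I_q -> B), rho (\sum_i x i * y i) = 1 /\
    forall a, exists c : 'I_q -> 'I_q -> k, forall i,
      rho (a * x i - \sum_j talg_in (c j i) * x j) = 0 /\
      rho (y i * a - \sum_j talg_in (c i j) * y j) = 0.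
Proof.
move=> sepB.
have [||S dS] := @vspace_of_set _ _ (fun u => exists b, u = rho b).
- by exists 0; rewrite rmorph0.
- move=> c _ _ [a ->] [b ->]; exists (talg_in c * a + b).
  by rewrite rmorphD rmorphM rho_in -mul_scalar_mx.
have [||E|q [x [y [xS yS xy1 dual]]]] := @universal_dual_bases _ _ S.
- by apply/dS; exists 1; rewrite rmorph1.
- by move=> _ _ /dS[a ->] /dS[b ->]; apply/dS; exists (a * b); rewrite rmorphM.
- exact: rho_ext_regular (sepB E).
have /choice[x' Dx] := fun i => (dS _).1 (xS i).
have /choice[y' Dy] := fun i => (dS _).1 (yS i).
exists q, x', y'; split.
  rewrite rmorph_sum -xy1; apply: eq_bigr => i _; by rewrite rmorphM Dx Dy.
move=> a; have [|c Hc] := dual (rho a); first by apply/dS; exists a.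
exists c => i; have [H1 H2] := Hc i; rewrite !rmorphB !rmorphM -Dx -Dy H1 H2 !rmorph_sum.
by split; apply/eqP; rewrite subr_eq0; apply/eqP; apply: eq_bigr => j _;
  rewrite rmorphM rho_in -mul_scalar_mx ?Dx ?Dy.
Qed.

End SeparableImage.

(** * Closed supplements of the radical *)

Section Saturated.
Variable A : topologicalZmodType.
Implicit Types (U X N : set A).

Lemma sub_continuous (x : A) : continuous (fun z : A => x - z).
Proof.
move=> z; apply: (@continuous_comp _ _ _ (fun z : A => (x, - z))
  (fun z : A * A => z.1 + z.2)).
  by apply: cvg_pair => /=; [exact: cvg_cst | exact: opp_continuous].
exact: add_continuous.
Qed.

Lemma nbhs_sub (x : A) U : nbhs x U -> nbhs (0 : A) [set z | U (x - z)].
Proof.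
move=> xU; have x0U : nbhs (x - 0) U by rewrite subr0.
exact: (@sub_continuous x 0 U x0U).
Qed.

(** A set stable under small translations is closed. *)
Lemma saturated_closed X N : nbhs (0 : A) N ->
  (forall x z, X x -> N (x - z) -> X z) -> closed X.
Proof.
by move=> N0 XN z clz; have [x [Xx Nxz]] := clz _ (nbhs_translate z N0); exact: XN Nxz.
Qed.

End Saturated.

Section Supplement.
Variables (k : fieldType) (A : pseudocompactAlgType k).
Implicit Types (C I : set A).
Local Notation J := (jacobson A).
Local Notation pi := (mod_jacobson_proj A).

(** Subalgebras, unital and containing the scalars. *)
Definition subalgebra C := [/\ C 1, forall x y, C x -> C y -> C (x - y),
  forall x y, C x -> C y -> C (x * y) & forall c, C (talg_in c)].

(** Closed subalgebras [C] with [C + J = A]. *)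
Definition supplement C :=
  [/\ closed C, subalgebra C & forall a, exists2 c, C c & J (a - c)].

Let Jl : left_ideal J. Proof. by have [] := jacobson_two_sided A. Qed.
Let Jr x a : J x -> J (x * a). Proof. by have [_] := jacobson_two_sided A; apply. Qed.
Let J0 : J 0. Proof. by have [] := Jl. Qed.
Let JD x y : J x -> J y -> J (x + y). Proof. by have [_ + _] := Jl; apply. Qed.
Let JM a x : J x -> J (a * x). Proof. by have [_ _] := Jl; apply. Qed.
Let JN x : J x -> J (- x). Proof. by rewrite -mulN1r; exact: JM. Qed.

Let J_closed : closed J.
Proof. by apply: closed_bigI => M []. Qed.

Section SubalgebraTheory.
Variable C : set A.
Hypothesis Csub : subalgebra C.
Let CB x y : C x -> C y -> C (x - y). Proof. by case: Csub => _ + _ _; apply. Qed.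
Lemma subalgebra0 : C 0.
Proof. by case: Csub => C1 _ _ _; rewrite -(subrr 1); exact: CB. Qed.
Lemma subalgebraD x y : C x -> C y -> C (x + y).
Proof.
move=> Cx Cy; rewrite -[y]opprK -[- y]sub0r; apply: CB => //; apply: CB => //.
exact: subalgebra0.
Qed.
Lemma subalgebraZ c x : C x -> C (talg_in c * x).
Proof. by case: Csub => _ _ CM Cin Cx; apply: CM. Qed.
End SubalgebraTheory.

(** For an open ideal [I] of finite codimension, [C ∩ I + J] is a neighbourhood of
    [0]: it contains any open ideal [I'] for which the image modulo [I] of
    [C ∩ (J + I')] is smallest. *)
Lemma supplement_open C I : supplement C -> two_sided_ideal I -> finite_codim I ->
    nbhs (0 : A) I ->
  exists2 N, nbhs (0 : A) N & forall a, N a -> exists c, [/\ C c, I c & J (a - c)].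
Proof.
move=> [Cc Csub CJ] Iid fI I0; have [Il _] := Iid.
have [_ CB _ _] := Csub.
have [n [rho [rhoZ rhoP]]] := ideal_linear_rep Iid fI.
have [B [BI BU B0]] := @pc_basis k A.
have Bl I' : B I' -> left_ideal I' by move=> /BI[[]].
have Bdown I1 I2 : B I1 -> B I2 -> exists2 I3, B I3 & I3 `<=` I1 `&` I2.
  by move=> BI1 BI2; apply: BU; apply: filterI; [have [] := BI _ BI1 | have [] := BI _ BI2].
pose CI I' := [set c | C c /\ exists2 j, J j & I' (c - j)].
have CIS I1 I2 : I1 `<=` I2 -> CI I1 `<=` CI I2.
  by move=> I12 c [Cc' [j Jj Icj]]; split=> //; exists j => //; exact: I12.
pose img I' (U : {vspace 'M[k]_n.+1}) :=
  forall u, u \in U <-> exists2 c, CI I' c & u = rho c.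
have imgP I' : B I' -> exists V : {vspace 'M[k]_n.+1}, img I' V.
  move=> /Bl[I'0 I'D I'M]; apply: vspace_of_set.
    exists 0; last by rewrite raddf0.
    split; first exact: subalgebra0.
    by exists 0; rewrite ?subr0.
  move=> c _ _ [x [Cx [j Jj Ixj]] ->] [y [Cy [l Jl' Iyl]] ->].
  exists (talg_in c * x + y); last by rewrite raddfD rhoZ.
  split; first by apply: subalgebraD => //; exact: subalgebraZ.
  exists (talg_in c * j + l); first by apply: JD => //; exact: JM.
  by rewrite opprD addrACA -mulrBr; apply: I'D => //; exact: I'M.
have [I1 BI1 _] := BU _ (filterT : nbhs (0 : A) setT).
have [U1 dU1] := imgP _ BI1.
have [|U [I' BI' dU] Umin] := @min_vspace _ _ (fun V => exists2 I', B I' & img I' V) U1.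
  by exists I1.
exists I'; first by have [] := BI _ BI'.
move=> a I'a; have [c Cc' Jac] := CJ a.
have CIc : CI I' c.
  split=> //; exists (- (a - c)); first exact: JN.
  by rewrite opprK subrKC.
have Uc I2 : B I2 -> exists2 c', CI I2 c' & rho c' = rho c.
  move=> BI2; have [I3 BI3 I3s] := Bdown _ _ BI' BI2.
  have [U3 dU3] := imgP _ BI3.
  have E : U3 = U.
    apply: Umin; first by exists I3.
    apply/subvP => _ /dU3[c' CIc' ->]; apply/dU; exists c' => //.
    by apply: CIS CIc' => x /I3s[].
  have /dU3[c' CIc' Ec] : rho c \in U3 by rewrite E; apply/dU; exists c.
  by exists c' => //; apply: CIS CIc' => x /I3s[].
(* An element common to all [W I2] lies in the closure of [J], which is [J],
   and is congruent to [c] modulo [I]. *)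
pose W I2 := C `&` [set c' | (exists2 j, J j & I2 (c' - j)) /\ rho c' = rho c].
have WS I1' I2 : I1' `<=` I2 -> W I1' `<=` W I2.
  move=> I12 c' [Cc1 [[j Jj Icj] Ec]]; split=> //; split=> //.
  by exists j => //; exact: I12.
have [|||c' Wc'] := @linear_compactness k A (W @` B).
- by exists (W I'), I'.
- move=> _ [I2 BI2 <-]; have [I20 I2D I2M] := Bl _ BI2; split.
    split.
      by have [c' [Cc1 Icj] Ec] := Uc _ BI2; exists c'.
    move=> d x y z [Cx [[j1 Jj1 Ij1] Ex]] [Cy [[j2 Jj2 Ij2] Ey]] [Cz [[j3 Jj3 Ij3] Ez]].
    split; first by apply: subalgebraD => //; apply: subalgebraZ => //; exact: CB.
    split; last by rewrite raddfD rhoZ raddfB Ex Ey Ez subrr scaler0 addr0.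
    exists (j1 + talg_in d * (j2 - j3)).
      by apply: JD => //; apply: JM; apply: JD => //; exact: JN.
    rewrite opprD addrACA -mulrBr; apply: I2D => //; apply: I2M.
    have := idealB (Bl _ BI2) Ij2 Ij3.
    by congr I2; rewrite !opprB addrACA [RHS]addrACA [- j2 - z]addrC.
  apply: closedI => //.
  apply: (@saturated_closed _ _ (I `&` I2)).
    by apply: filterI => //; have [] := BI _ BI2.
  move=> x z [[j Jj Ixj] Ex] [Ixz I2xz]; split.
    exists j => //; have := idealB (Bl _ BI2) Ixj I2xz.
    by congr I2; rewrite opprB addrC addrA subrK.
  by move/rhoP: Ixz; rewrite raddfB Ex => /eqP; rewrite subr_eq0 => /eqP.
- move=> _ _ [I2 BI2 <-] [I3 BI3 <-]; have [I4 BI4 I4s] := Bdown _ _ BI2 BI3.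
  exists (W I4); first by exists I4.
  by move=> x Wx; split; apply: WS Wx => y /I4s[].
have Jc' : J c'.
  apply: J_closed => X /nbhs_sub/BU[I2 BI2 I2X].
  have [_ [[j Jj Icj] _]] := Wc' _ (imageP W BI2); exists j; split=> //.
  by have := I2X _ Icj; rewrite /= subKr.
have [Cc1 [_ Ec]] := Wc' _ (imageP W BI').
exists (c - c'); split; first exact: CB.
  by apply/rhoP; rewrite raddfB Ec subrr.
by rewrite opprB addrA; rewrite addrAC; exact: JD.
Qed.

(** For each [a], the sets of [c] in [C] with [a - c] in [J] form a chain of closed
    affine sets. *)
Lemma supplement_chain (G : set (set A)) : (forall C, G C -> supplement C) ->
  (exists C, G C) -> (forall C C', G C -> G C' -> C `<=` C' \/ C' `<=` C) ->
  supplement (\bigcap_(C in G) C).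
Proof.
move=> Gs [C0 GC0] Gtot; split.
- by apply: closed_bigI => C /Gs[].
- split.
  + by move=> C /Gs[_ []].
  + move=> x y Cx Cy C GC; have [_ [_ CB _ _] _] := Gs _ GC.
    by apply: CB; [exact: Cx | exact: Cy].
  + move=> x y Cx Cy C GC; have [_ [_ _ CM _] _] := Gs _ GC.
    by apply: CM; [exact: Cx | exact: Cy].
  + by move=> c C /Gs[_ []].
move=> a; pose W C := C `&` [set c | J (a - c)].
have [|||c Wc] := @linear_compactness k A (W @` G).
- by exists (W C0), C0.
- move=> _ [C GC <-]; have [Cc Csub CJ] := Gs _ GC; split.
    split; first by have [c Cc' Jc] := CJ a; exists c.
    have [_ CB _ _] := Csub.
    move=> d x y z [Cx Jx] [Cy Jy] [Cz Jz]; split.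
      by apply: subalgebraD => //; apply: subalgebraZ => //; exact: CB.
    rewrite /= opprD addrA; apply: JD => //; apply: JN; apply: JM.
    by have := idealB Jl Jz Jy; rewrite opprB addrC addrA subrK.
  apply: closedI => //.
  by apply: (@preimage_closed _ _ (fun c : A => a - c) J) => // y _; exact: sub_continuous.
- move=> _ _ [C GC <-] [C' GC' <-].
  case: (Gtot _ _ GC GC') => CC.
    by exists (W C); [exists C | move=> x [Cx Jx]; split; split=> //; exact: CC].
  by exists (W C'); [exists C' | move=> x [Cx Jx]; split; split=> //; exact: CC].
exists c; last by have [] := Wc _ (imageP W GC0).
by move=> C GC; have [] := Wc _ (imageP W GC).
Qed.

Lemma minimal_supplement : exists C, supplement C /\
  forall C', supplement C' -> C' `<=` C -> C `<=` C'.
Proof.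
have supT : supplement setT.
  split; [exact: closedT | by split |].
  by move=> a; exists a; rewrite ?subrr.
(* Zorn's lemma is applied to the set-theoretic complements. *)
have [F [supF Fmax]] : exists F, supplement (~` F) /\
    forall F', F `<` F' -> ~ supplement (~` F').
  apply: (@Zorn_bigcup _ (fun F => supplement (~` F))) => G Gs Gtot.
  rewrite setC_bigcup.
  (* [setT] is added to cover the empty chain. *)
  have -> : \bigcap_(X in G) ~` X = \bigcap_(C in [set ~` X | X in G] `|` [set setT]) C.
    apply/seteqP; split=> x Gx.
      by move=> _ [[X GX <-]|->] //; exact: Gx.
    by move=> X GX; apply: Gx; left; exists X.
  apply: supplement_chain.
  - by move=> _ [[X GX <-]|->] //; exact: Gs.
  - by exists setT; right.
  - move=> _ _ [[X GX <-]|->] [[Y GY <-]|->]; [|by left|by right|by left].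
    by case: (Gtot _ _ GX GY) => XY; [right | left]; exact: subsetC.
exists (~` F); split=> // C' supC' C'F x Fx; apply: contrapT => C'x.
apply: (Fmax (~` C')); last by rewrite setCK.
split; first by move=> y Fy C'y; exact: C'F _ C'y Fy.
by move=> /(_ _ C'x).
Qed.

(** Dual bases of [A / J] modulo the open ideal [Q], the image of [C ∩ I], lifted to
    [C].  Lifts of elements of [Q] lie in [X = C ∩ I + J]; the image of [I] itself
    would be too large, since [C ∩ (I + J)] may exceed [C ∩ I + C ∩ J]. *)
Lemma supplement_dual_bases C I : separable (mod_jacobson A) -> supplement C ->
    two_sided_ideal I -> finite_codim I -> nbhs (0 : A) I ->
  let X := [set z | exists c j, [/\ C c, I c, J j & z = c + j]] in
  exists q (x y : 'I_q -> A), [/\ forall i, C (x i), forall i, C (y i),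
    X (\sum_i x i * y i - 1)
    & forall a, exists c : 'I_q -> 'I_q -> k, forall i,
      X (a * x i - \sum_j talg_in (c j i) * x j) /\
      X (y i * a - \sum_j talg_in (c i j) * y j)].
Proof.
move=> sepAJ supC Iid fI I0 X; have [Cc Csub CJ] := supC; have [_ _ CM _] := Csub.
have [[Il0 ID IM] Ir] := Iid.
pose Q : set (mod_jacobson A) := [set q | exists c, [/\ C c, I c & q = pi c]].
have lift q : exists c, C c /\ pi c = q.
  have [x ->] := quot_piP q; have [c Cc' Jxc] := CJ x; exists c; split=> //.
  apply/eqP; rewrite -subr_eq0 -rmorphB; apply/eqP/mod_jacobson_ker.
  by rewrite -opprB; exact: JN.
have QX z : Q (pi z) -> X z.
  move=> [c [Cc' Ic /eqP]]; rewrite -subr_eq0 -rmorphB => /eqP/mod_jacobson_ker Jzc.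
  by exists c, (z - c); rewrite subrKC.
have Ql : two_sided_ideal Q.
  split; first split.
  - by exists 0; rewrite rmorph0; split=> //; exact: subalgebra0.
  - move=> _ _ [c [Cc' Ic ->]] [d [Cd Id ->]]; exists (c + d).
    by rewrite rmorphD; split=> //; [exact: subalgebraD | exact: ID].
  - move=> q _ [c [Cc' Ic ->]]; have [d [Cd <-]] := lift q; exists (d * c).
    by rewrite rmorphM; split=> //; [exact: CM | exact: IM].
  - move=> _ q [c [Cc' Ic ->]]; have [d [Cd <-]] := lift q; exists (c * d).
    by rewrite rmorphM; split=> //; [exact: CM | exact: Ir].
have [N N0 HN] := supplement_open supC Iid fI I0.
have NQ a : N a -> Q (pi a).
  move=> /HN[c [Cc' Ic Jac]]; exists c; split=> //.
  by apply/eqP; rewrite -subr_eq0 -rmorphB; apply/eqP/mod_jacobson_ker.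
have Qo : nbhs (0 : mod_jacobson A) Q.
  have := @quot_pi_open k A (@jacobson_pred k A) _ _ N0.
  rewrite quot_pi0; apply: filterS => _ [a Na <-]; exact: NQ.
have Qf : finite_codim Q.
  have [B [BI BU _]] := @pc_basis k A.
  have [I' BI' I'N] := BU _ N0; have [_ _ [n [v Hv]]] := BI _ BI'.
  exists n, (pi \o v) => q; have [a ->] := quot_piP q; have [c Hc] := Hv a.
  exists c; have := NQ _ (I'N _ Hc).
  rewrite rmorphB rmorph_sum; congr (Q (_ - _)).
  by apply: eq_bigr => i _; rewrite rmorphM.
suff [q [x [y [xy1 dual]]]] : exists q (x y : 'I_q -> mod_jacobson A),
    Q (\sum_i x i * y i - 1) /\ forall a, exists c : 'I_q -> 'I_q -> k, forall i,
      Q (a * x i - \sum_j talg_in (c j i) * x j) /\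
      Q (y i * a - \sum_j talg_in (c i j) * y j).
  have /choice[x' Hx] := fun i => lift (x i).
  have /choice[y' Hy] := fun i => lift (y i).
  have Dx i : x i = pi (x' i) by have [] := Hx i.
  have Dy i : y i = pi (y' i) by have [] := Hy i.
  exists q, x', y'; split.
  - by move=> i; have [] := Hx i.
  - by move=> i; have [] := Hy i.
  - apply: QX; rewrite rmorphB rmorph1 rmorph_sum; move: xy1; congr (Q (_ - _)).
    by apply: eq_bigr => i _; rewrite rmorphM Dx Dy.
  move=> a; have [c Hc] := dual (pi a); exists c => i; have [H1 H2] := Hc i.
  split; apply: QX; rewrite rmorphB rmorph_sum rmorphM.
    move: H1; rewrite Dx; congr (Q (_ - _)).
    by apply: eq_bigr => j _; rewrite rmorphM Dx.
  move: H2; rewrite Dy; congr (Q (_ - _)).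
  by apply: eq_bigr => j _; rewrite rmorphM Dy.
(* If [Q] is the whole algebra, empty families are dual bases modulo [Q]. *)
have [Q1|Q1] := pselect (Q 1).
  exists 0%N, (fun=> 0), (fun=> 0); split; last by move=> a; exists (fun _ _ => 0); case.
  rewrite big_ord0 sub0r -mulN1r; by have [[_ _ QM] _] := Ql; exact: QM.
have [n [rho [rho_in rhoP]]] := ideal_rep Ql Qf Q1.
have rho_open : nbhs (0 : mod_jacobson A) [set x | rho x = 0].
  by apply: filterS Qo => x /rhoP.
have [q [x [y [xy1 dual]]]] := separable_image_dual_bases rho_in rho_open sepAJ.
exists q, x, y; split; first by apply/rhoP; rewrite rmorphB rmorph1 xy1 subrr.
move=> a; have [c Hc] := dual a; exists c => i; have [H1 H2] := Hc i.
by split; apply/rhoP.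
Qed.

(** The smaller supplement is the preimage in [C] of the subalgebra [D'] given by
    [splitting_step] with [K = M * M]. *)
Lemma shrink_supplement C I : separable (mod_jacobson A) -> supplement C ->
    two_sided_ideal I -> finite_codim I -> nbhs (0 : A) I ->
    ~ C `&` J `<=` I ->
  exists C', [/\ supplement C', C' `<=` C & ~ C `<=` C'].
Proof.
move=> sepAJ supC Iid fI I0 CJI; have [Cc Csub CJ] := supC.
have [C1 CB CM Cin] := Csub; have [Il Ir] := Iid.
have I1 : ~ I 1.
  move=> I1; apply: CJI => x _; rewrite -[x]mulr1; by have [_ _ IM] := Il; exact: IM.
have [n [rho [rho_in rhoP]]] := ideal_rep Iid fI I1.
have rho_open : nbhs (0 : A) [set x | rho x = 0] by apply: filterS I0 => x /rhoP.
have rhoZ c x : rho (talg_in c * x) = c *: rho x.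
  by rewrite rmorphM rho_in -mul_scalar_mx.
have [||D dD] := @vspace_of_set _ _ (fun u => exists2 c, C c & u = rho c).
- by exists 0; rewrite ?rmorph0 //; exact: subalgebra0.
- move=> c _ _ [x Cx ->] [y Cy ->]; exists (talg_in c * x + y).
    by apply: subalgebraD => //; exact: subalgebraZ.
  by rewrite rmorphD rhoZ.
have [||M dM] := @vspace_of_set _ _ (fun u => exists2 c, (C `&` J) c & u = rho c).
- by exists 0; rewrite ?rmorph0 //; split=> //; exact: subalgebra0.
- move=> c _ _ [x [Cx Jx] ->] [y [Cy Jy] ->]; exists (talg_in c * x + y).
    by split; [apply: subalgebraD => //; exact: subalgebraZ | apply: JD => //; exact: JM].
  by rewrite rmorphD rhoZ.
have MD : {subset M <= D} by move=> u /dM[c [Cc' _] ->]; apply/dD; exists c.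
have DM_M x y : x \in D -> y \in M -> x * y \in M.
  move=> /dD[a Ca ->] /dM[b [Cb Jb] ->]; apply/dM; exists (a * b); last by rewrite rmorphM.
  by split; [exact: CM | exact: JM].
have MD_M x y : x \in M -> y \in D -> x * y \in M.
  move=> /dM[b [Cb Jb] ->] /dD[a Ca ->]; apply/dM; exists (b * a); last by rewrite rmorphM.
  by split; [exact: CM | exact: Jr].
have DM : {in D &, forall x y, x * y \in D}.
  move=> _ _ /dD[a Ca ->] /dD[b Cb ->]; apply/dD.
  by exists (a * b); [exact: CM | rewrite rmorphM].
have D1 : 1 \in D by apply/dD; exists 1; rewrite ?rmorph1.
have M_nil m : m \in M -> exists j, m ^+ j = 0.
  by move=> /dM[c [_ Jc] ->]; exact: radical_nil.
have XM z : C z -> (exists c j, [/\ C c, I c, J j & z = c + j]) -> rho z \in M.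
  move=> Cz [c [j [Cc' Ic Jj E]]]; apply/dM; exists (z - c).
    by split; [exact: CB | rewrite E addrC addKr].
  by rewrite rmorphB ((rhoP c).2 Ic) subr0.
have Csum m (F : 'I_m -> A) : (forall i, C (F i)) -> C (\sum_i F i).
  by move=> CF; elim/big_ind: _ => //; [exact: subalgebra0 | exact: subalgebraD].
have [q [x [y [Cx Cy xy1 dual]]]] := supplement_dual_bases sepAJ supC Iid fI I0.
have M0 : M != 0%VS.
  apply/negP => /eqP M0; apply: CJI => c CJc; apply/rhoP/eqP.
  by rewrite -memv0 -M0; apply/dM; exists c.
have [m mM mMM] := nil_square_proper MD DM_M M_nil M0.
have MM_K u v : u \in M -> v \in M -> u * v \in (M * M)%VS by exact: memv_mul.
have DK_K u v : u \in D -> v \in (M * M)%VS -> u * v \in (M * M)%VS.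
  move=> uD vK; have : u * v \in (D * (M * M))%VS by exact: memv_mul.
  rewrite prodvA; apply/subvP/prodvSl; apply/prodvP => *; exact: DM_M.
have KD_K u v : u \in (M * M)%VS -> v \in D -> u * v \in (M * M)%VS.
  move=> uK vD; have : u * v \in (M * M * D)%VS by exact: memv_mul.
  rewrite -prodvA; apply/subvP/prodvSr; apply/prodvP => *; exact: MD_M.
have xD i : rho (x i) \in D by apply/dD; exists (x i).
have yD i : rho (y i) \in D by apply/dD; exists (y i).
have rxy1 : \sum_i rho (x i) * rho (y i) - 1 \in M.
  have Cxy : C (\sum_i x i * y i - 1) by apply: CB => //; apply: Csum => i; exact: CM.
  have := XM _ Cxy xy1; rewrite rmorphB rmorph1 rmorph_sum.
  by under eq_bigr do rewrite rmorphM.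
have rdual a : a \in D -> exists c : 'I_q -> 'I_q -> k, forall i,
    a * rho (x i) - \sum_j c j i *: rho (x j) \in M /\
    rho (y i) * a - \sum_j c i j *: rho (y j) \in M.
  move=> /dD[b Cb ->]; have [c Hc] := dual b; exists c => i.
  have [H1 H2] := Hc i; split.
    have Cz : C (b * x i - \sum_j talg_in (c j i) * x j).
      by apply: CB; [exact: CM | apply: Csum => j; exact: subalgebraZ].
    have := XM _ Cz H1; rewrite rmorphB rmorphM rmorph_sum.
    by under eq_bigr do rewrite rhoZ.
  have Cz : C (y i * b - \sum_j talg_in (c i j) * y j).
    by apply: CB; [exact: CM | apply: Csum => j; exact: subalgebraZ].
  have := XM _ Cz H2; rewrite rmorphB rmorphM rmorph_sum.
  by under eq_bigr do rewrite rhoZ.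
have [D' [D'D D'1 D'M D'S D'K]] :=
  splitting_step D1 DM MD DM_M MD_M MM_K DK_K KD_K xD yD rxy1 rdual.
exists (C `&` [set c | rho c \in D']); split; last first.
- move=> CC'; have /dM[c [Cc' Jc] E] := mM.
  have [_ /= cD'] := CC' _ Cc'.
  by case/negP: mMM; rewrite D'K // E.
- by move=> c [].
split.
- apply: closedI => //; apply: (saturated_closed rho_open) => a z /= aD'.
  by rewrite rmorphB => /eqP; rewrite subr_eq0 => /eqP <-.
- split.
  + by split=> //=; rewrite rmorph1.
  + by move=> a b [Ca aD'] [Cb bD']; split; [exact: CB | rewrite /= rmorphB memvB].
  + by move=> a b [Ca aD'] [Cb bD']; split; [exact: CM | rewrite /= rmorphM D'M].
  + by move=> c; split=> //=; rewrite rho_in -scalemx1 memvZ.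
move=> a; have [c Cc' Jac] := CJ a.
have [|u /dM[z [Cz Jz] ->] uD'] := D'S (rho c); first by apply/dD; exists c.
exists (c - z); first by split; [exact: CB | rewrite /= rmorphB].
by rewrite opprB addrCA addrC; exact: JD.
Qed.

End Supplement.

Theorem theorem4p6 (k : fieldType) (A : pseudocompactAlgType k)
    (sepAJ : separable (mod_jacobson A)) :
  exists s : {rmorphism mod_jacobson A -> A},
    [/\ continuous s,
        forall c : k, s (talg_in c) = talg_in c
      & forall q : mod_jacobson A, mod_jacobson_proj A (s q) = q].
Proof.
have [C [Csup Cmin]] := minimal_supplement A.
have [Cc Csub CJ] := Csup; have [C1 CB CM Cin] := Csub.
have [B [BI BU B0]] := @pc_basis k A.
have CJ0 x : C x -> jacobson A x -> x = 0.
  move=> Cx Jx; suff : [set 0] x by []; rewrite -B0 => I IB.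
  have [Iid I0 fI] := BI _ IB.
  apply: contrapT => nIx.
  have [|C' [C'sup C'C nCC']] := shrink_supplement sepAJ Csup Iid fI I0.
    by move=> H; apply: nIx; exact: H.
  by apply: nCC'; exact: Cmin.
have piE x y : mod_jacobson_proj A x = mod_jacobson_proj A y <-> jacobson A (x - y).
  rewrite -mod_jacobson_ker rmorphB; split=> [->|/eqP]; first by rewrite subrr.
  by rewrite subr_eq0 => /eqP.
have lift q : exists c, C c /\ mod_jacobson_proj A c = q.
  have [x ->] := quot_piP q; have [c Cc' Jxc] := CJ x; exists c; split=> //.
  by apply/esym/piE.
have [s Hs] := choice lift.
have sC q : C (s q) by have [] := Hs q.
have pis q : mod_jacobson_proj A (s q) = q by have [] := Hs q.
have sU c : C c -> s (mod_jacobson_proj A c) = c.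
  move=> Cc'; apply/eqP; rewrite -subr_eq0; apply/eqP; apply: CJ0; first exact: CB.
  by apply/piE.
have sB : zmod_morphism s.
  by move=> p q; rewrite -[RHS]sU ?rmorphB ?pis //; exact: CB.
have sM : monoid_morphism s.
  split=> [|p q]; first by rewrite -[RHS]sU ?rmorph1.
  by rewrite -[RHS]sU ?rmorphM ?pis //; exact: CM.
pose f : {rmorphism mod_jacobson A -> A} := HB.pack s
  (GRing.isZmodMorphism.Build _ _ s sB) (GRing.isMonoidMorphism.Build _ _ s sM).
exists f; split=> //; last by move=> c; rewrite -[RHS]sU.
move=> q U Uq.
have [I IB IU] := BU _ (@nbhs_sub A (s q) U Uq).
have [Iid I0 fI] := BI _ IB.
have [N N0 HN] := supplement_open Csup Iid fI I0.
have := @quot_pi_open k A (@jacobson_pred k A) _ _ (nbhs_translate (s q) N0).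
rewrite -[quot_pi _ _]/(mod_jacobson_proj A _) pis; apply: filterS.
move=> _ [a /= Na <-]; have [c [Cc' Ic Jc]] := HN _ Na.
have -> : s (quot_pi _ a) = s q + c.
  rewrite -[RHS]sU; last exact: subalgebraD.
  by congr s; apply/piE; rewrite opprD addrA.
have [[_ _ IM] _] := Iid.
have := IU (- c); rewrite /= opprK; apply.
by rewrite -mulN1r; exact: IM.
Qed.
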